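(* Let $p\in(0,1)$, $q=1-p$, $x\in\mathbb{R}$ and $a\in(0,\tfrac12]$. Put $m_n=\lfloor n/p-xn^a\rfloor$. Then $$\varlimsup_{n\to\infty}\mathbb{E}\bigl[R^{(\mathrm{ind})}_{m_n,n}\bigr]\le\begin{cases}2, & a<\tfrac12,\\ \bigl(1-\Phi(xpq^{-1/2})\bigr)^{-1}, & a=\tfrac12,\end{cases}$$ where $R^{(\mathrm{ind})}_{m,n}$ is the number of optimality regions of the independent model with terminal point $(m,n)$ and $\Phi$ is the cumulative distribution function of the standard Gaussian distribution.
   Context: Independent model: $\omega=(\omega_{i,j})_{i,j\ge 1}$ is a field of i.i.d. Bernoulli random variables with $\mathbb{P}\{\omega_{i,j}=1\}=p=1-\mathbb{P}\{\omega_{i,j}=0\}$. An admissible path from $(0,0)$ to $(m,n)$ is a lattice path whose increments all lie in $\{e_1,e_2,e_1+e_2\}$. For an admissible path $\pi$, a match is a step $e_1+e_2$ whose endpoint $(i,j)$ has $\omega_{i,j}=1$, a mismatch is a step $e_1+e_2$ whose endpoint has $\omega_{i,j}=0$, and a gap is a step $e_1$ or $e_2$. Let $x(\pi),y(\pi),z(\pi)$ be the numbers of mismatches, gaps and matches of $\pi$. Optimality regions: for parameters $(\alpha,\beta)\in[0,\infty)^2$ the score of $\pi$ is $z(\pi)-\alpha x(\pi)-\beta y(\pi)$. Let $\Gamma^{(\alpha,\beta)}_{0,(m,n)}$ be the set of minimal-gap maximisers, i.e. the admissible paths from $(0,0)$ to $(m,n)$ that maximise the score and, among the maximisers, have the smallest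 number of gaps. For fixed $(m,n)$ and $\omega$, two points $(\alpha_1,\beta_1)$ and $(\alpha_2,\beta_2)$ of $[0,\infty)^2$ belong to different optimality regions if and only if $\Gamma^{(\alpha_1,\beta_1)}_{0,(m,n)}\cap\Gamma^{(\alpha_2,\beta_2)}_{0,(m,n)}=\varnothing$; thus an optimality region is a maximal subset of the parameter space $[0,\infty)^2$ on which the set of optimal paths (in this sense) does not change. $R^{(\mathrm{ind})}_{m,n}$ denotes the number of optimality regions (it suffices to count them along the line $\alpha=0$). *)

(* Defs.v *)
From HB Require Import structures.
From mathcomp Require Import all_boot all_order all_algebra finmap.
From mathcomp Require Import all_classical all_reals all_analysis.

Set Implicit Arguments.
Unset Strict Implicit.
Unset Printing Implicit Defensive.

Import Order.TTheory GRing.Theory Num.Theory.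
Import numFieldNormedType.Exports.

Local Open Scope classical_set_scope.
Local Open Scope ring_scope.

Definition site : Type := (nat * nat)%type.
Definition origin : site := (0%N, 0%N).

Definition gap_step (u v : site) : bool :=
  (v == (u.1.+1, u.2)) || (v == (u.1, u.2.+1)).
Definition diag_step (u v : site) : bool := v == (u.1.+1, u.2.+1).
Definition lattice_step (u v : site) : bool := gap_step u v || diag_step u v.

(* A path from the origin is the sequence of its successive vertices, the
   origin itself being left out. *)
Definition admissible (m n : nat) (pi : seq site) : bool :=
  path lattice_step origin pi && (last origin pi == (m, n)).

Definition steps (pi : seq site) : seq (site * site) :=
  zip (origin :: pi) pi.

Definition mismatches (w : site -> bool) (pi : seq site) : nat :=
  count (fun s => diag_step s.1 s.2 && ~~ w s.2) (steps pi).
Definition gaps (pi : seq site) : nat :=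
  count (fun s => gap_step s.1 s.2) (steps pi).
Definition matches (w : site -> bool) (pi : seq site) : nat :=
  count (fun s => diag_step s.1 s.2 && w s.2) (steps pi).

Section Regions.
Variables (R : realType) (w : site -> bool) (m n : nat).
Implicit Types (ab cd : R * R) (pi : seq site).

Definition parameters : set (R * R) := [set ab | 0 <= ab.1 /\ 0 <= ab.2].

Definition score ab pi : R :=
  (matches w pi)%:R - ab.1 * (mismatches w pi)%:R - ab.2 * (gaps pi)%:R.

Definition maximisers ab : set (seq site) :=
  [set pi | admissible m n pi /\
     forall pi', admissible m n pi' -> score ab pi' <= score ab pi].

Definition min_gap_maximisers ab : set (seq site) :=
  [set pi | maximisers ab pi /\
     forall pi', maximisers ab pi' -> (gaps pi <= gaps pi')%N].

Definition different_regions ab cd : Prop :=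
  min_gap_maximisers ab `&` min_gap_maximisers cd = set0.

Definition region ab : set (R * R) :=
  [set cd | parameters cd /\ ~ different_regions ab cd].

Definition regions : set (set (R * R)) := region @` parameters.

(* [fset_set] is meaningful on finite sets only; see [finite_regions]. *)
Definition num_regions : nat := #|` fset_set regions|.

Lemma lattice_step_le u v :
  lattice_step u v -> [/\ u.1 <= v.1, u.2 <= v.2 & u.1 + u.2 < v.1 + v.2]%N.
Proof.
by case/orP=> [/orP[]|] /eqP-> /=; split; rewrite ?leqnSn ?leqnn ?addSn ?addnS.
Qed.

Lemma lattice_path_bound u pi : path lattice_step u pi ->
  let v := last u pi in
  [/\ u.1 <= v.1, u.2 <= v.2, (size pi + (u.1 + u.2) <= v.1 + v.2)%N
    & all (fun z => (z.1 <= v.1) && (z.2 <= v.2))%N pi]%N.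
Proof.
elim: pi u => [|z pi IH] u /=; first by rewrite !leqnn.
case/andP=> /lattice_step_le[l1 l2 l3] /IH[h1 h2 h3 h4]; split.
- exact: leq_trans l1 h1.
- exact: leq_trans l2 h2.
- by rewrite addSnnS (leq_trans _ h3)// leq_add2l.
- by rewrite h1 h2 h4.
Qed.

Lemma finite_regions : finite_set regions.
Proof.
pose B := {bseq (m + n) of 'I_m.+1 * 'I_n.+1}.
pose f (b : B) : seq site := [seq (val z.1, val z.2) | z <- b].
pose F (A : {set B}) : set (R * R) := [set cd | parameters cd /\
  ~ ([set f b | b in [set` A]] `&` min_gap_maximisers cd = set0)].
apply: (@sub_finite_set _ _ [set F A | A in [set: {set B}]]); last first.
  exact/finite_image/finite_finset.
move=> _ [ab abP <-]; exists [set b | f b \in min_gap_maximisers ab]%SET => //.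
rewrite /F /region /different_regions.
suff -> : [set f b | b in [set` [set b | f b \in min_gap_maximisers ab]%SET]]
          = min_gap_maximisers ab by [].
apply/seteqP; split=> [_ [b /= + <-]|pi piG]; first by rewrite !inE.
have [[/andP[/lattice_path_bound/= [_ _ + +] /eqP lpi] _] _] := piG.
rewrite lpi /= !addn0 => spi apt.
pose s := [seq (inord z.1, inord z.2) | z <- pi] : seq ('I_m.+1 * 'I_n.+1).
have ss : (size s <= m + n)%N by rewrite size_map.
have fs : f (Bseq ss) = pi.
  rewrite /f /= /s -map_comp -[RHS]map_id; apply/eq_in_map => z /(allP apt)/=.
  by case: z => i j /= /andP[im jn]; rewrite !inordK.
by exists (Bseq ss) => //=; rewrite inE fs; exact/mem_set.
Qed.

End Regions.

Section IndependentModel.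
Context (R : realType) (d : measure_display) (T : measurableType d).
Variable P : probability T R.

Definition mutually_independent (I : choiceType) (d' : measure_display)
    (U : measurableType d') (D : set I) (X : I -> {RV P >-> U}) : Prop :=
  forall (J : {fset I}) (A : I -> set U),
    [set` J] `<=` D -> (forall i, measurable (A i)) ->
    P (\bigcap_(i in [set` J]) (X i @^-1` A i)) =
    (\prod_(i <- J) P (X i @^-1` A i))%E.

Definition positive_sites : set site := [set ij | (0 < ij.1)%N /\ (0 < ij.2)%N].

Definition iid_bernoulli_field (p : R) (omega : site -> {RV P >-> bool}) : Prop :=
  mutually_independent positive_sites omega /\
  forall ij, positive_sites ij ->
    P [set t | omega ij t = true] = p%:E /\
    P [set t | omega ij t = false] = (1 - p)%:E.

End IndependentModel.

Definition Phi (R : realType) (y : R) : R := fine (normal_prob 0 1 `]-oo, y]).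

(* [Num.truncn] is the floor of a nonnegative real, and 0 on negative reals:
   for given p, x and a <= 1/2, the latter occurs for finitely many n only. *)
Definition terminal_abscissa (R : realType) (p x a : R) (n : nat) : nat :=
  Num.truncn (n%:R / p - x * n%:R `^ a).

(* Main.v *)
Require Import Defs.
From mathcomp Require Import all_boot all_order all_algebra finmap.
From mathcomp Require Import all_classical all_reals all_analysis.
From mathcomp Require Import measurable_realfun.
From mathcomp Require Import ring lra zify.
Import Order.TTheory GRing.Theory Num.Theory.
Import numFieldNormedType.Exports.
Local Open Scope classical_set_scope.
Local Open Scope ring_scope.

Set Implicit Arguments.
Unset Strict Implicit.
Unset Printing Implicit Defensive.

(** The score of a path is an affine function of its number [d] of diagonal steps and
    of its number of matches. At a given parameter all the optimal paths with fewest
    gaps have the same [d], which labels the optimality regions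
    ([min_gap_maximisers_transfer]). It is at most [n], and at least the largest number
    of matches of a mismatch-free path ([diagonals_ge]). The number of regions is thus
    at most one plus the number of rows that such a path must give up
    ([num_regions_le]).

    Sweep the columns with a family of explorers at strictly increasing heights,
    starting from height [i] for the [i]-th one. In each column every explorer
    inspects the site just above its height and climbs one row if it finds a one;
    an explorer that is caught up by the one below is pushed one row up. Explorer
    [i] follows a path that gives up at most [i] rows ([reach_pointers]). No site is
    inspected twice, so the bits found by the explorers are independent Bernoulli
    variables ([P_readout]), although the sites depend on the configuration: given
    the bits, the sites are known. If more than [k] rows must be given up, then each
    of the explorers 0, ..., k finds fewer than [n] ones among [m], an event of
    probability at most F^(k+1), where F is the probability that a binomial
    variable with parameters [m] and [p] is smaller than [n] ([P_stuck]). Summing the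
    geometric series bounds the expected number of regions by 1 / (1 - F)
    ([expectation_num_regions]).

    It remains to find the limit of F when [m] is [terminal_abscissa p x a n], which
    is the central limit theorem. As a function of the success probability, F has
    for derivative a multiple of the density t^(n-1) (1-t)^(m-n)
    ([is_derive_binomial_lt]), hence F is a ratio of two integrals of that density.
    Rescaled around its maximum, the density converges to exp (- s^2 / 2) and is
    dominated by a Gaussian function ([beta_kernel_cvg], [beta_kernel_le_gauss]), so
    both integrals converge ([binomial_lt_cvg]). In the critical direction the
    rescaled position of [p] tends to x p / sqrt q if a = 1/2, and to 0 if
    a < 1/2 ([standardised_cvg]), whence the two cases of the bound: the Gaussian
    distribution function is 1/2 at 0 ([Phi0]). *)

(** * Lattice paths *)

Definition diagonals (pi : seq site) : nat :=
  count (fun s => diag_step s.1 s.2) (steps pi).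

Lemma diagonalsE w pi : diagonals pi = (matches w pi + mismatches w pi)%N.
Proof.
rewrite /diagonals /matches /mismatches addnC; elim: (steps pi) => //= s l ->.
by case: (diag_step _ _); case: (w _) => /=; lia.
Qed.

Lemma steps_rcons pi v : steps (rcons pi v) = rcons (steps pi) (last origin pi, v).
Proof.
rewrite /steps; elim: pi origin => [//|u pi IH] o.
by move: (IH u) => /= ->.
Qed.

Lemma count_rcons T (a : pred T) s x : count a (rcons s x) = (count a s + a x)%N.
Proof. by rewrite -cats1 count_cat /= addn0. Qed.

Lemma path_coordinates u pi : path lattice_step u pi ->
  let dg := count (fun s => diag_step s.1 s.2) (zip (u :: pi) pi) in
  let gp := count (fun s => gap_step s.1 s.2) (zip (u :: pi) pi) in
  ((last u pi).1 + (last u pi).2 = u.1 + u.2 + gp + dg.*2 /\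
   (last u pi).2 >= u.2 + dg)%N.
Proof.
elim: pi u => [|v pi IH] u /=; first by rewrite !addn0.
case/andP=> uv /IH /=; case: u uv => u1 u2; case: v => v1 v2.
rewrite /lattice_step /gap_step /diag_step !xpair_eqE /=.
by case/orP=> [/orP[]|] /andP[/eqP-> /eqP->] /=; lia.
Qed.

Lemma gaps_diagonals m n pi : admissible m n pi ->
  (m + n = gaps pi + (diagonals pi).*2)%N /\ (diagonals pi <= n)%N.
Proof.
case/andP=> /path_coordinates /= + /eqP lpi.
by rewrite lpi /= !add0n.
Qed.

(** Ruling out mismatches is what lets one path serve as a competitor at every
    parameter: its score is then independent of the mismatch penalty. *)
Definition reach (w : site -> bool) (t N l : nat) : Prop :=
  exists pi, [/\ admissible t N pi, mismatches w pi = 0%N & (l <= matches w pi)%N].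

Lemma reach_extend w t N l t' N' : reach w t N l ->
    lattice_step (t, N) (t', N') ->
    (diag_step (t, N) (t', N') -> w (t', N')) ->
  reach w t' N' (l + diag_step (t, N) (t', N')).
Proof.
move=> [pi [/andP[ppi /eqP lpi] x0 zl]] st dw; exists (rcons pi (t', N')).
rewrite /admissible rcons_path ppi lpi st last_rcons eqxx.
rewrite /mismatches /matches !steps_rcons !count_rcons -/(mismatches w pi) lpi /=.
rewrite x0 -/(matches w pi); case: diag_step dw => /=; last by split; lia.
by move=> -> //; split=> //; lia.
Qed.

Lemma reach_weaken w t N l l' : (l' <= l)%N -> reach w t N l -> reach w t N l'.
Proof. by move=> ll [pi [? ? ?]]; exists pi; split=> //; lia. Qed.

Lemma reach_gap1 w t N l : reach w t N l -> reach w t.+1 N l.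
Proof.
move=> /(@reach_extend _ _ _ _ t.+1 N).
rewrite /lattice_step /gap_step /diag_step !xpair_eqE /= !eqxx /=.
by rewrite (ltn_eqF (ltnSn N)) /= addn0; apply.
Qed.

Lemma reach_gap2 w t N l : reach w t N l -> reach w t N.+1 l.
Proof.
move=> /(@reach_extend _ _ _ _ t N.+1).
rewrite /lattice_step /gap_step /diag_step !xpair_eqE /= !eqxx /=.
by rewrite (ltn_eqF (ltnSn t)) /= addn0; apply.
Qed.

Lemma reach_match (w : site -> bool) t N l :
  w (t.+1, N.+1) -> reach w t N l -> reach w t.+1 N.+1 l.+1.
Proof.
move=> wt /(@reach_extend _ _ _ _ t.+1 N.+1).
rewrite /lattice_step /diag_step eqxx orbT addn1; exact.
Qed.

Lemma reach0 w t N : reach w t N 0.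
Proof.
elim: t => [|t]; last exact: reach_gap1.
by elim: N => [|N]; [exists [::]|exact: reach_gap2].
Qed.

(** * The greedy explorers *)

(** One column of the exploration. Explorer [i] climbs by the bit [b i] that it
    reads, and is pushed up so as to stay strictly above explorer [i - 1]: the
    two then never read the same site. *)
Fixpoint advance (r : nat -> nat) (b : nat -> bool) (i : nat) : nat :=
  if i is j.+1 then maxn (r i + b i) (advance r b j).+1 else (r 0 + b 0)%N.

Fixpoint pointers (b : nat -> nat -> bool) (t : nat) : nat -> nat :=
  if t is s.+1 then advance (pointers b s) (b s) else id.

Lemma advance_ge r (b : nat -> bool) i : (r i + b i <= advance r b i)%N.
Proof. by case: i => [|i] //=; rewrite leq_max leqnn. Qed.

Lemma pointers_lt (b : nat -> nat -> bool) t i j : (i < j)%N ->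
  (pointers b t i < pointers b t j)%N.
Proof.
move: i j; apply: (homo_ltn ltn_trans) => i; case: t => [//|t] /=.
by rewrite leq_max leqnn orbT.
Qed.

(** A push only helps an explorer, so its height dominates the number of ones
    that it reads: a binomial variable. *)
Lemma pointers_ge (b : nat -> nat -> bool) t i :
  (i + \sum_(s < t) b s i <= pointers b t i)%N.
Proof.
elim: t => [|t IH]; first by rewrite big_ord0 addn0.
rewrite big_ord_recr /= addnA; apply: leq_trans (advance_ge _ _ _).
by rewrite leq_add2r.
Qed.

Lemma eq_pointers b c m k :
    (forall t i, (t < m)%N -> (i < k)%N -> b t i = c t i) ->
  forall t i, (t <= m)%N -> (i < k)%N -> pointers b t i = pointers c t i.
Proof.
move=> bc; elim=> [//|t IH] i tm.
have tm' : (t <= m)%N by exact: ltnW.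
elim: i => [|i IHi] ik /=; first by rewrite IH// bc.
by rewrite IH// bc//; congr (maxn _ _.+1); exact/IHi/ltnW.
Qed.

Definition site_read (b : nat -> nat -> bool) (t i : nat) : site :=
  (t.+1, (pointers b t i).+1).

(** Explorers sit at distinct heights of a column, and distinct columns are
    disjoint: along a fixed array of bits, no site is read twice. *)
Lemma site_read_inj b t i s j : site_read b t i = site_read b s j ->
  t = s /\ i = j.
Proof.
by case=> <-; case: (ltngtP i j) => // /(pointers_lt b t) + e; rewrite e ltnn.
Qed.

(** The heights driven by the configuration itself; the bits found on the way
    form the array that the next lemma provides. *)
Fixpoint explorer (w : site -> bool) (t : nat) : nat -> nat :=
  if t is s.+1 then advance (explorer w s) (fun i => w (s.+1, (explorer w s i).+1))
  else id.

Lemma reading_exists (w : site -> bool) :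
  exists b, forall t i, b t i = w (site_read b t i).
Proof.
pose b t i := w (t.+1, (explorer w t i).+1).
have bE t : pointers b t = explorer w t by elim: t => //= t ->.
by exists b => t i; rewrite /site_read bE.
Qed.

(** Explorer [i] has given up at most [i] rows. A climb is a match, and a push
    by explorer [i - 1] moves to one row above it, by a vertical gap which uses
    up one more row; hence the loss [i] in the number of matches. *)
Lemma reach_pointers (w : site -> bool) b : (forall t i, b t i = w (site_read b t i)) ->
  forall t i N, (N <= pointers b t i)%N -> reach w t N (N - i).
Proof.
move=> bw; elim=> [|t IH] i N.
  by move=> /= Ni; rewrite (eqP (Ni : N - i == 0)%N); exact: reach0.
have own j M : (M <= pointers b t j + b t j)%N -> reach w t.+1 M (M - j).
  have [Mr _|] := leqP M (pointers b t j); first exact/reach_gap1/IH.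
  case: (boolP (b t j)) => [bj rM Mr|_]; last by lia.
  have -> : M = (pointers b t j).+1 by lia.
  apply: (@reach_weaken _ _ _ (pointers b t j - j).+1); first by lia.
  by apply: reach_match; [rewrite -[w _]bw|exact: IH].
elim: i N => [|i IHi] N /=; first exact: own.
rewrite leq_max => /orP[/own//|]; case: N => [_|N]; first exact: reach0.
by rewrite ltnS subSS => /IHi/reach_gap2.
Qed.

(** * Counting the regions of a fixed configuration *)

Section RegionCount.
Variables (R : realType) (w : site -> bool) (m n : nat).
Implicit Types (ab cd : R * R) (pi : seq site).

(** The end point being given, gaps and mismatches are affine functions of the
    matches and the diagonal steps. *)
Lemma scoreE ab pi : admissible m n pi ->
  score w ab pi = (1 + ab.1) * (matches w pi)%:R
    + (2 * ab.2 - ab.1) * (diagonals pi)%:R - ab.2 * (m + n)%:R.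
Proof.
move=> /gaps_diagonals[-> _].
rewrite /score (diagonalsE w) -muln2 !(natrD, natrM); ring.
Qed.

(** The score takes finitely many values, as it depends on the bounded pair
    (matches, mismatches). *)
Lemma min_gap_maximiser_exists ab : exists pi, min_gap_maximisers w m n ab pi.
Proof.
have [pi0 [adm0 _ _]] := reach0 w m n.
have le_diag pi : admissible m n pi ->
    (matches w pi < n.+1)%N /\ (mismatches w pi < n.+1)%N.
  by move=> /gaps_diagonals[_]; rewrite (diagonalsE w); lia.
pose Q (c : 'I_n.+1 * 'I_n.+1) := `[< exists pi, [/\ admissible m n pi,
  matches w pi = c.1 & mismatches w pi = c.2] >].
pose val (c : 'I_n.+1 * 'I_n.+1) : R := (1 + ab.1) * (c.1 : nat)%:R
    + (2 * ab.2 - ab.1) * (c.1 + c.2)%:R - ab.2 * (m + n)%:R.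
have toQ pi (pip : admissible m n pi) : exists2 c, Q c & val c = score w ab pi.
  have [zn xn] := le_diag pi pip.
  exists (Ordinal zn, Ordinal xn); first by apply/asboolP; exists pi.
  by rewrite (scoreE _ pip) (diagonalsE w).
have [c0 Qc0 _] := toQ _ adm0.
have [c Qc cmax] := @arg_maxP _ _ _ c0 Q val Qc0.
have [pi1 [adm1 z1 x1]] := asboolP _ Qc.
have max1 : maximisers w m n ab pi1.
  split=> // pi' /toQ[c' /cmax + <-]; congr (_ <= _).
  by rewrite (scoreE _ adm1) (diagonalsE w) z1 x1.
have exg : exists g, `[< exists2 pi, maximisers w m n ab pi & gaps pi = g >].
  by exists (gaps pi1); apply/asboolP; exists pi1.
have [g /asboolP[pi mpi <-] gmin] := ex_minnP exg.
by exists pi; split=> // pi' mpi'; apply: gmin; apply/asboolP; exists pi'.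
Qed.

Lemma min_gap_maximisers_diagonals ab pi pi' :
    min_gap_maximisers w m n ab pi -> min_gap_maximisers w m n ab pi' ->
  diagonals pi = diagonals pi'.
Proof.
move=> [mpi gpi] [mpi' gpi'].
have := gpi _ mpi'; have := gpi' _ mpi.
case: mpi mpi' => /gaps_diagonals[h _] _ [/gaps_diagonals[h' _] _]; lia.
Qed.

(** Optimal paths of two parameters with equally many diagonal steps also have
    equally many matches, since each of them beats the other; so they score the
    same everywhere. Hence the diagonal count labels the regions faithfully. *)
Lemma min_gap_maximisers_transfer ab cd pi pi' :
    parameters ab -> parameters cd -> diagonals pi = diagonals pi' ->
    min_gap_maximisers w m n ab pi -> min_gap_maximisers w m n cd pi' ->
  min_gap_maximisers w m n cd pi.
Proof.
move=> [a0 b0] [c0 d0] dd [[adm mx] gm] [[adm' mx'] gm'].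
have zz : matches w pi = matches w pi'.
  apply/eqP; rewrite eqn_leq -2!(ler_nat R).
  have := mx _ adm'; have := mx' _ adm.
  by rewrite !scoreE// dd !lerD2r !ler_pM2l ?ltr_pwDl// => -> ->.
have ss (ef : R * R) : score w ef pi = score w ef pi' by rewrite !scoreE// dd zz.
have gg : gaps pi = gaps pi'.
  by move: adm adm' => /gaps_diagonals[h _] /gaps_diagonals[h' _]; lia.
split; last by rewrite gg.
by split=> // rho /mx'; rewrite ss.
Qed.

(** With [z] matches and [x] mismatches the score is, up to a constant,
    (1 + 2 beta) z + (2 beta - alpha) x, which is at most (1 + 2 beta) (z + x).
    A mismatch-free path with [l] matches attains (1 + 2 beta) l, so optimality
    forces z + x >= l. *)
Lemma diagonals_ge ab pi l : parameters ab -> reach w m n l ->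
  min_gap_maximisers w m n ab pi -> (l <= diagonals pi)%N.
Proof.
move=> [a0 b0] [rho [adm' x0 zl]] [[adm mx] _].
rewrite leqNgt; apply/negP => dl.
have := mx _ adm'; rewrite !scoreE//; apply/negP; rewrite -ltNge.
rewrite ltrD2r !(diagonalsE w) x0 addn0.
rewrite (diagonalsE w) in dl.
have : ((matches w pi + mismatches w pi)%:R + 1 <= (matches w rho)%:R :> R).
  by rewrite natr1 ler_nat; lia.
rewrite !natrD.
have : 0 <= (mismatches w pi)%:R :> R by [].
move: (matches w pi)%:R (mismatches w pi)%:R (matches w rho)%:R => z y r y0 zr.
have h1 : 0 <= (2 * ab.2) * (r - z - y - 1).
  by apply: mulr_ge0; [rewrite mulr_ge0|lra].
have h2 : 0 <= ab.1 * y by exact: mulr_ge0.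
have h3 : 0 <= ab.2 by [].
nra.
Qed.

(** The labels of the regions lie between [l] and [n]. *)
Lemma num_regions_le l : reach w m n l -> (num_regions R w m n <= (n - l).+1)%N.
Proof.
move=> rl.
pose G (j : nat) : set (R * R) := [set cd | parameters cd /\
   exists2 pi, min_gap_maximisers w m n cd pi & diagonals pi = (l + j)%N].
have sub : regions w m n `<=` G @` `I_(n - l).+1.
  move=> _ [ab abp <-].
  have [pi mpi] := min_gap_maximiser_exists ab.
  have ld := diagonals_ge abp rl mpi.
  have [_ dn] := gaps_diagonals mpi.1.1.
  exists (diagonals pi - l)%N => /=; first by lia.
  apply/seteqP; split=> [cd [cdp [rho mrho]]|cd [cdp]].
    rewrite subnKC// => dd; split=> // /seteqP[+ _] => /(_ rho); apply; split=> //.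
    exact: (min_gap_maximisers_transfer cdp abp dd).
  move=> /eqP/set0P[rho [mrho mrho']]; split=> //; exists rho => //.
  by rewrite subnKC// (min_gap_maximisers_diagonals mrho mpi).
rewrite /num_regions.
apply: geq_card_fset_set.
exact: card_le_trans (subset_card_le sub) (card_image_le _ _).
Qed.

End RegionCount.

(** * Independence of the explorers *)

Definition bit_weight (R : realType) (p : R) (b : bool) : R := if b then p else 1 - p.

(** The probability that a binomial variable with parameters [m] and [p] is
    smaller than [n], as a polynomial in [p]. *)
Definition binomial_lt (R : realType) (m n : nat) (p : R) : R :=
  \sum_(j < n) 'C(m, j)%:R * p ^+ j * (1 - p) ^+ (m - j).

(** Group the arrays by their number of ones. *)
Lemma sum_bit_weight (R : realType) (p : R) m n :
  \sum_(A : {set 'I_m} | (#|A| < n)%N) \prod_(s < m) bit_weight p (s \in A) =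
  binomial_lt m n p.
Proof.
have wA (A : {set 'I_m}) :
    \prod_(s < m) bit_weight p (s \in A) = p ^+ #|A| * (1 - p) ^+ (m - #|A|).
  rewrite (bigID (mem A)) /=; congr (_ * _).
    by rewrite -prodr_const; apply: eq_bigr => s ->.
  have -> : (m - #|A|)%N = #|~: A| by rewrite [RHS]cardsCs finset.setCK card_ord.
  rewrite -prodr_const; apply: eq_big => s; first by rewrite finset.in_setC.
  by move=> /negbTE ->.
have [n0|n0] := posnP n.
  by rewrite /binomial_lt n0 big_ord0 big_pred0.
rewrite (partition_big (fun A : {set 'I_m} => insubd (Ordinal n0) #|A|)
  (fun=> true))//=.
apply: eq_bigr => j _.
under eq_bigl => A.
  have -> : ((#|A| < n) && (insubd (Ordinal n0) #|A| == j))%N = (#|A| == j).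
    have [An|nA] := ltnP #|A| n; last first.
      by apply/esym/negbTE; rewrite neq_ltn (leq_trans (ltn_ord j) nA) orbT.
    by rewrite -val_eqE val_insubd An.
  over.
rewrite (eq_bigr (fun=> p ^+ j * (1 - p) ^+ (m - j))); last first.
  by move=> A /eqP Aj; rewrite wA Aj.
have -> : \sum_(A : {set 'I_m} | #|A| == j) p ^+ j * (1 - p) ^+ (m - j) =
    \sum_(A in [set A : {set 'I_m} | #|A| == j]%SET) p ^+ j * (1 - p) ^+ (m - j).
  by apply: eq_bigl => A; rewrite inE.
by rewrite sumr_const card_draws card_ord -[LHS]mulr_natl mulrA.
Qed.

(** Explorer [i] reads a one in column [s] exactly when [s] belongs to [c i]; the
    array is extended by zeroes so that it can drive [pointers]. *)
Definition table (m k : nat) (c : {ffun 'I_k -> {set 'I_m}}) (s i : nat) : bool :=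
  if (insub i, insub s) is (Some i', Some s') then s' \in c i' else false.

Lemma tableE m k (c : {ffun 'I_k -> {set 'I_m}}) (s : 'I_m) (i : 'I_k) :
  table c s i = (s \in c i).
Proof. by rewrite /table !valK. Qed.

(** The integral of a nonnegative function is a supremum over the simple functions
    below it, hence monotone even on functions such as the number of regions,
    whose measurability is not at hand. *)
Lemma ge0_integral_mono (R : realType) (d : measure_display)
    (T : measurableType d) (mu : {measure set T -> \bar R}) (f g : T -> \bar R) :
    (forall x, 0 <= f x)%E -> (forall x, f x <= g x)%E ->
  (\int[mu]_x f x <= \int[mu]_x g x)%E.
Proof.
move=> f0 fg; have g0 x : (0 <= g x)%E := le_trans (f0 x) (fg x).
rewrite !ge0_integralTE//; apply: ereal_sup_le => _ [h hf <-].
by exists h => // x; exact: le_trans (hf x) (fg x).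
Qed.

Definition read_sites (m k : nat) (b : nat -> nat -> bool) : {fset site} :=
  [fset site_read b x.2 x.1 | x : 'I_k * 'I_m in predT]%fset.

Section Failure.
Context (R : realType) (d : measure_display) (T : measurableType d).
Variables (P : probability T R) (p : R) (omega : site -> {RV P >-> bool}).
Hypotheses (p01 : 0 < p < 1) (homega : iid_bernoulli_field p omega).

Definition readout (m k : nat) (b : nat -> nat -> bool) : set T :=
  [set t | forall s i, (s < m)%N -> (i < k)%N -> omega (site_read b s i) t = b s i].

Lemma readout_bigcap m k b : readout m k b =
  \bigcap_(ij in [set` read_sites m k b])
    omega ij @^-1` [set c | forall x : 'I_k * 'I_m,
                               site_read b x.2 x.1 = ij -> c = b x.2 x.1].
Proof.
apply/seteqP; split=> [t tr ij|t tr s i sm ik] /=.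
  by move=> _ x <-; exact: tr.
apply: (tr (site_read b s i) _ (Ordinal ik, Ordinal sm)) => //=.
by apply/imfsetP; exists (Ordinal ik, Ordinal sm).
Qed.

Lemma measurable_readout m k b : measurable (readout m k b).
Proof.
rewrite readout_bigcap; apply: fin_bigcap_measurable => // ij _.
exact: measurable_funPTI.
Qed.

(** Once the array is prescribed, so are the heights of the explorers, hence the
    sites that they visit. The event constrains distinct deterministic sites, and
    the independence of the field applies directly. *)
Lemma P_readout m k b :
  P (readout m k b) = (\prod_(i < k) \prod_(s < m) bit_weight p (b s i))%:E.
Proof.
have [ind marg] := homega.
rewrite readout_bigcap ind//; last first.
  by move=> ij /= /imfsetP[x _ ->].
rewrite big_imfset/=; last first.
  move=> [i s] [j r] _ _ /= /site_read_inj[/val_inj -> /val_inj ->] //.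
rewrite pair_bigA /= -prodEFin big_enum /=; apply: eq_bigr => -[i s] _ /=.
have -> : omega (site_read b s i) @^-1` [set c | forall x : 'I_k * 'I_m,
    site_read b x.2 x.1 = site_read b s i -> c = b x.2 x.1] =
    [set t | omega (site_read b s i) t = b s i].
  apply/seteqP; split=> t /=; first by move/(_ (i, s)); exact.
  by move=> -> [i' s'] /= /site_read_inj[-> ->].
have [] := marg (site_read b s i) _; first by [].
by rewrite /bit_weight; case: (b s i).
Qed.

(** The event that each of the first [k] explorers reads fewer than [n] ones,
    presented as a finite union so as to be visibly measurable. *)
Definition stuck (m n k : nat) : set T :=
  \bigcup_(c in [set c : {ffun 'I_k -> {set 'I_m}} | forall i, (#|c i| < n)%N])
    readout m k (table c).

Lemma measurable_stuck m n k : measurable (stuck m n k).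
Proof.
by apply: fin_bigcup_measurable => // c _; exact: measurable_readout.
Qed.

(** The weight of an array factorises over the explorers, so summing over the
    arrays of the event gives the [k]-th power of a single binomial probability. *)
Lemma P_stuck m n k : (P (stuck m n k) <= (binomial_lt m n p ^+ k)%:E)%E.
Proof.
pose D := [set c : {ffun 'I_k -> {set 'I_m}} | [forall i, #|c i| < n]%N].
have stuckD : stuck m n k `<=` \bigcup_(c in D) readout m k (table c).
  by move=> t [c cn tr]; exists c => //; exact/forallP.
apply: le_trans (content_sub_fsum P _ _ _ stuckD) _.
- exact: finite_finset.
- by move=> c _; exact: measurable_readout.
- exact: measurable_stuck.
rewrite -(bigfs _ (index_enum_uniq _)); last first.
  by move=> c _; rewrite mem_index_enum.
rewrite (eq_bigr (fun c : {ffun 'I_k -> {set 'I_m}} =>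
    (\prod_(i < k) \prod_(s < m) bit_weight p (table c s i))%:E)); last first.
  by move=> c _; exact: P_readout.
rewrite sumEFin lee_fin -[in X in _ ^+ X](card_ord k) -prodr_const.
rewrite -sum_bit_weight bigA_distr_big /=.
rewrite (eq_bigl (fun c => c \in ffun_on (fun A : {set 'I_m} => #|A| < n)%N))//.
rewrite le_eqVlt; apply/predU1P; left.
apply: eq_bigr => c _; apply: eq_bigr => i _; apply: eq_bigr => s _.
by rewrite tableE.
Qed.

(** An explorer that reads [n] ones ends above row [n], with at most [k] matches
    missing there. *)
Lemma reach_of_not_stuck m n k t : ~ stuck m n k.+1 t ->
  reach (fun ij => omega ij t) m n (n - k).
Proof.
move=> ns; have [b bw] := reading_exists (fun ij => omega ij t).
pose c : {ffun 'I_k.+1 -> {set 'I_m}} :=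
    [ffun i : 'I_k.+1 => [set s : 'I_m | b s i]%SET].
have bc s i : (s < m)%N -> (i < k.+1)%N -> b s i = table c s i.
  move=> sm ik; rewrite (tableE c (Ordinal sm) (Ordinal ik)) ffunE inE //.
have [cn|] := boolP [forall i, #|c i| < n]%N.
  exfalso; apply: ns; exists c; first by move=> i; exact: (forallP cn).
  move=> s i sm ik; rewrite /site_read -(eq_pointers bc) ?(ltnW sm)// -bc//.
rewrite negb_forall => /existsP[i]; rewrite -leqNgt => nc.
have nr : (n <= pointers b m i)%N.
  apply: leq_trans nc (leq_trans _ (pointers_ge b m i)).
  rewrite ffunE (leq_trans _ (leq_addl _ _))// -sum1_card big_mkcond /=.
  by apply: leq_sum => s _; rewrite inE; case: (b s i).
apply: reach_weaken (reach_pointers bw nr).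
by have := ltn_ord i; lia.
Qed.

(** If there are more than [k.+1] regions, then [stuck m n k.+1] holds by the
    previous lemma, so all the regions but one are counted by an indicator. *)
Lemma num_regions_stuck m n t :
  ((num_regions R (fun ij => omega ij t) m n)%:R <=
     1 + \sum_(k < n) \1_(stuck m n k.+1) t :> R).
Proof.
pose w ij := omega ij t; set r := num_regions _ _ _ _.
have rn : (r <= n.+1)%N by have := num_regions_le R (reach0 w m n); rewrite subn0.
have rk k : ~ stuck m n k.+1 t -> (r <= k.+1)%N.
  by move=> /reach_of_not_stuck/(num_regions_le R) h; apply: leq_trans h _; lia.
apply: (@le_trans _ _ (1 + \sum_(k < n) (k.+1 < r)%N%:R)).
  rewrite -natr_sum -(natrD _ 1) ler_nat -[X in (X <= _)%N](minn_idPl rn).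
  clear rn rk; clearbody r; elim: n => [|l IH]; first by rewrite big_ord0 geq_minr.
  rewrite big_ord_recr /= addnA; move: IH.
  move: (\sum_(_ < _) _)%N => S.
  by case: (ltnP l.+1 r) => _; rewrite ?addn1 ?addn0; lia.
rewrite lerD2l; apply: ler_sum => k _; rewrite indicE.
case: (boolP (k.+1 < r)%N) => //= kr; rewrite mem_set//.
by apply: contrapT => /rk; rewrite leqNgt kr.
Qed.

(** The bound is the sum of the geometric series of ratio [binomial_lt m n p]. *)
Lemma expectation_num_regions m n : binomial_lt m n p < 1 ->
  ('E_P[fun t => (num_regions R (fun ij => omega ij t) m n)%:R] <=
     ((1 - binomial_lt m n p)^-1)%:E)%E.
Proof.
move=> F1; rewrite unlock.
set F := binomial_lt m n p in F1 *.
have F0 : 0 <= F.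
  have /andP[p0 p1] := p01.
  by apply: sumr_ge0 => j _; rewrite !mulr_ge0// exprn_ge0// ?subr_ge0 ltW.
apply: (@le_trans _ _ (\int[P]_t
    (1 + \sum_(k < n) (\1_(stuck m n k.+1) t)%:E))%E).
  apply: ge0_integral_mono => t; first by rewrite lee_fin.
  by rewrite sumEFin -EFinD lee_fin num_regions_stuck.
have ms k : measurable_fun [set: T] (fun t => (\1_(stuck m n k) t : R)%:E).
  by apply/measurable_EFinP/measurable_indic/measurable_stuck.
rewrite ge0_integralD//; last 2 first.
- by move=> t _; apply: sume_ge0 => k _; rewrite lee_fin.
- by apply: emeasurable_sum.
rewrite ge0_integral_sum//.
have -> : (\int[P]_t 1 = 1)%E.
  by rewrite integral_cst// mul1e; exact: probability_setT.
apply: (@le_trans _ _ (1 + \sum_(k < n) (F ^+ k.+1)%:E)%E).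
  apply: leeD2l; apply: lee_sum => k _.
  by rewrite integral_indic ?setIT ?P_stuck//; exact: measurable_stuck.
rewrite sumEFin -EFinD lee_fin.
rewrite -[leRHS]mul1r ler_pdivlMr ?subr_gt0//.
have := subrX1 F n.+1; rewrite big_ord_recl expr0 /=.
have : 0 <= F ^+ n.+1 by exact: exprn_ge0.
under eq_bigr do rewrite /bump /= add1n.
nra.
Qed.

End Failure.

(** * The binomial tail as an incomplete Beta integral *)

Section BinomialTail.
Variable R : realType.
Implicit Types (p s t : R) (A B : nat).

Lemma eq_is_derive (f g : R -> R) (x a b : R) :
  is_derive x 1 f a -> f =1 g -> a = b -> is_derive x 1 g b.
Proof. by move=> + /funext <- <-. Qed.

Lemma is_derive_onemX (k : nat) (t : R) :
  is_derive t 1 (fun u => (1 - u) ^+ k) (- (k%:R * (1 - t) ^+ k.-1)).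
Proof.
have h : is_derive t 1 (fun u : R => 1 - u) (- 1).
  by apply: eq_is_derive (is_deriveB (is_derive_cst (1 : R) t 1) (is_derive_id t 1)) _ _;
    rewrite ?sub0r.
apply: eq_is_derive (is_deriveX k h) _ _ => [u|]; first by rewrite exprfctE.
by rewrite /GRing.scale /=; ring.
Qed.

(** The derivative telescopes, leaving the density of a Beta law. *)
Lemma is_derive_binomial_lt A B (t : R) :
  is_derive t 1 (binomial_lt (A + B).+1 A.+1)
    (- ((A + B).+1%:R * 'C(A + B, A)%:R * (t ^+ A * (1 - t) ^+ B))).
Proof.
have [N NE] : exists N, N = (A + B)%N by exists (A + B)%N.
have AN : (A <= N)%N by rewrite NE leq_addr.
have -> : B = (N - A)%N by rewrite NE addKn.
rewrite subnKC// {NE B}.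
elim: A AN => [|A IH] AN.
  have -> : binomial_lt N.+1 1 = (fun u : R => (1 - u) ^+ N.+1).
    by apply/funext => u; rewrite /binomial_lt big_ord1 bin0 expr0 !mul1r subn0.
  apply: eq_is_derive (is_derive_onemX _ _) _ _ => //.
  by rewrite bin0 expr0 subn0 /=; ring.
have {}IH := IH (ltnW AN).
have -> : binomial_lt N.+1 A.+2 = (binomial_lt N.+1 A.+1 : R -> R)
    + (fun u : R => 'C(N.+1, A.+1)%:R * (u ^+ A.+1 * (1 - u) ^+ (N - A))).
  apply/funext => u; rewrite /binomial_lt big_ord_recr /= subSS -mulrA.
  by [].
have h := is_deriveM (is_deriveX A.+1 (is_derive_id t 1)) (is_derive_onemX (N - A) t).
have {}h := is_deriveM (is_derive_cst ('C(N.+1, A.+1)%:R : R) t 1) h.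
apply: eq_is_derive (is_deriveD IH h) _ _ => [u|]; first by rewrite exprfctE.
have e1 : 'C(N.+1, A.+1)%:R * A.+1%:R = N.+1%:R * 'C(N, A)%:R :> R.
  by rewrite -!natrM mulnC -mul_bin_diag.
have e2 : 'C(N.+1, A.+1)%:R * (N - A)%:R = N.+1%:R * 'C(N, A.+1)%:R :> R.
  by rewrite -!natrM mulnC -subSS -mul_bin_down.
rewrite exprfctE -!e1 -!e2 /GRing.scale /= subnS !mulr0 addr0 mulr1 exprS /cst.
ring.
Qed.

(** The derivative u^2 / (1 + u) of ln (1 + u) - u + u^2 / 2 is nonnegative, which
    fixes the sign of the remainder, and is at most 2 u^2 when |u| <= 1/2, which
    bounds its size. The sign serves to dominate the rescaled Beta densities by a
    Gaussian function, and the size to find their pointwise limit. *)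
Lemma ln_taylor2 (y : R) : -1 < y ->
  exists2 r, 0 <= r & ln (1 + y) = y - y ^+ 2 / 2 + r * y /\
    (`|y| <= 1 / 2 -> r <= 2 * y ^+ 2).
Proof.
move=> y1.
pose h (u : R) := ln (1 + u) - u + u ^+ 2 / 2.
have dh (u : R) : -1 < u -> is_derive u 1 h (u ^+ 2 / (1 + u)).
  move=> u1; have u1' : 0 < 1 + u by lra.
  have h1 : is_derive u 1 (fun v : R => 1 + v) 1.
    by apply: eq_is_derive (is_deriveD (is_derive_cst (1 : R) u 1) (is_derive_id u 1)) _ _;
      rewrite ?add0r.
  have h2 := is_derive1_comp (is_derive1_ln u1') h1.
  have h3 := is_deriveM (is_deriveX 2 (is_derive_id u 1)) (is_derive_cst (2^-1 : R) u 1).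
  apply: eq_is_derive (is_deriveD (is_deriveB h2 (is_derive_id _ _)) h3) _ _ => //.
  rewrite /GRing.scale /= /cst.
  field; exact: lt0r_neq0.
have h0 : h 0 = 0 by rewrite /h addr0 ln1 expr0n /= mul0r; lra.
have hc (u v : R) : -1 < u -> {within `[u, v], continuous h}.
  move=> u1; apply: derivable_within_continuous => z.
  by rewrite in_itv /= => /andP[uz _]; have [] := dh z (lt_le_trans u1 uz).
suff [c c1 hy] : exists2 c, `|c| <= `|y| /\ -1 < c & h y = c ^+ 2 / (1 + c) * y.
  have c0 : 0 < 1 + c by case: c1; lra.
  exists (c ^+ 2 / (1 + c)); first by rewrite divr_ge0 ?sqr_ge0 ?ltW.
  split; first by move: hy; rewrite /h => <-; ring.
  move=> y2; have [cy _] := c1.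
  rewrite ler_pdivrMr//.
  have c2 : c ^+ 2 <= y ^+ 2.
    by rewrite -(real_normK (num_real c)) -(real_normK (num_real y)) lerXn2r ?nnegrE.
  have : 1 / 2 <= 1 + c.
    have : - c <= `|c| by rewrite -normrN ler_norm.
    lra.
  have := sqr_ge0 y; nra.
have [y0|y0|->] := ltgtP y 0.
- have [] := @MVT R h (fun u => u ^+ 2 / (1 + u)) y 0 y0 _ (hc _ _ y1).
    by move=> u; rewrite in_itv /= => /andP[yu _]; apply: dh; lra.
  move=> c; rewrite in_itv /= => /andP[yc c0] hE; exists c.
    by rewrite !ltr0_norm//; split; lra.
  by move: hE; rewrite h0; lra.
- have [] := @MVT R h (fun u => u ^+ 2 / (1 + u)) 0 y y0 _ (hc _ _ _).
  + by move=> u; rewrite in_itv /= => /andP[yu _]; apply: dh; lra.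
  + by lra.
  move=> c; rewrite in_itv /= => /andP[yc c0] hE; exists c.
    by rewrite !gtr0_norm//; split; lra.
  by move: hE; rewrite h0; lra.
- by exists 0; [rewrite normr0; split; lra|rewrite h0 mulr0].
Qed.

End BinomialTail.

(** * The rescaled Beta density *)

Section Kernel.
Variable R : realType.
Implicit Types (c s t y : R) (A B : nat).
Notation mu := (@lebesgue_measure R).

Definition slope A B : R := Num.sqrt (B%:R / (A%:R * (A + B)%:R)).

(** The Beta density t^A (1 - t)^B divided by its maximum, reached at A / (A + B),
    in the coordinate [s] such that t = A / (A + B) * (1 - slope A B * s). The scale
    makes the second derivative of the logarithm at the maximum s = 0 equal to -1;
    the sign makes binomial tails increase with [s]. Truncating the factors at 0
    extends the function by 0 to the points [s] that correspond to no t in [0, 1]. *)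
Definition beta_kernel A B s : R :=
  (Num.max 0 (1 - slope A B * s)) ^+ A * (Num.max 0 (1 + slope B A * s)) ^+ B.

Lemma beta_kernelN A B s : beta_kernel A B (- s) = beta_kernel B A s.
Proof. by rewrite /beta_kernel mulrN opprK mulrN mulrC. Qed.

Lemma beta_kernel_ge0 A B s : 0 <= beta_kernel A B s.
Proof. by rewrite mulr_ge0// exprn_ge0// le_max lexx. Qed.

Lemma slope_ge0 A B : 0 <= slope A B. Proof. exact: sqrtr_ge0. Qed.

Lemma slope_gt0 A B : (0 < A)%N -> (0 < B)%N -> 0 < slope A B.
Proof. by move=> A0 B0; rewrite sqrtr_gt0 divr_gt0 ?mulr_gt0 ?ltr0n ?addn_gt0 ?A0. Qed.

(** Together with the same identity for [B] and [A], this says that the second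
    order coefficients of the two factors add up to one. *)
Lemma slope_sqr A B : (0 < A)%N -> A%:R * slope A B ^+ 2 = B%:R / (A + B)%:R :> R.
Proof.
move=> A0; rewrite sqr_sqrtr ?divr_ge0//.
by field; rewrite -!natrD !pnatr_eq0; lia.
Qed.

(** The first order terms of the two factors cancel. *)
Lemma slope_balance A B : (0 < A)%N -> (0 < B)%N ->
  A%:R * slope A B = B%:R * slope B A :> R.
Proof.
move=> A0 B0; apply/eqP; rewrite -(@eqrXn2 _ 2) ?mulr_ge0 ?slope_ge0//.
rewrite !exprMn !expr2 -!mulrA -!expr2 !slope_sqr// [(B + A)%N]addnC.
by apply/eqP; field; rewrite -!natrD !pnatr_eq0; lia.
Qed.

Lemma max0_le_expR y : Num.max 0 (1 + y) <= expR y.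
Proof. by rewrite ge_max expR_ge0 expR_ge1Dx. Qed.

Lemma max0_le_expR2 y : y <= 0 -> Num.max 0 (1 + y) <= expR (y - y ^+ 2 / 2).
Proof.
move=> y0; rewrite ge_max expR_ge0 /=.
have [y1|y1] := leP (1 + y) 0; first exact: le_trans y1 (expR_ge0 _).
rewrite -[leLHS]lnK// ler_expR; have [|r r0 [-> _]] := @ln_taylor2 R y; first by lra.
by rewrite gerDl mulr_ge0_le0.
Qed.

(** On the half-line where the first factor is below 1, its second order expansion
    is an upper bound and the other factor is bounded by its exponential; the
    linear terms cancel. The reflection [beta_kernelN] handles the other side. *)
Lemma beta_kernel_le_gauss A B c s : (0 < A)%N -> (0 < B)%N ->
    c <= A%:R / (A + B)%:R -> c <= B%:R / (A + B)%:R ->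
  beta_kernel A B s <= expR (- (c * s ^+ 2 / 2)).
Proof.
wlog s0 : A B s / 0 <= s => [hw A0 B0 cA cB|A0 B0 cA cB].
  have [s0|s0] := leP 0 s; first exact: hw.
  rewrite -[s]opprK beta_kernelN sqrrN; apply: hw => //; rewrite 1?addnC//.
  by rewrite oppr_ge0 ltW.
rewrite /beta_kernel.
apply: (@le_trans _ _ (expR (- (slope A B * s) - (- (slope A B * s)) ^+ 2 / 2) ^+ A *
   expR (slope B A * s) ^+ B)).
  apply: ler_pM; rewrite ?exprn_ge0 ?le_max ?lexx//.
    by rewrite lerXn2r ?nnegrE ?le_max ?lexx ?expR_ge0// max0_le_expR2//
      oppr_le0 mulr_ge0 ?slope_ge0.
  by rewrite lerXn2r ?nnegrE ?le_max ?lexx ?expR_ge0// max0_le_expR.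
rewrite -!expRM_natl -expRD ler_expR.
have -> : A%:R * (- (slope A B * s) - (- (slope A B * s)) ^+ 2 / 2)
    + B%:R * (slope B A * s) = (B%:R * slope B A - A%:R * slope A B) * s
    - A%:R * slope A B ^+ 2 * s ^+ 2 / 2 by field.
rewrite slope_balance// subrr mul0r add0r lerN2 slope_sqr//.
by rewrite ler_pM2r// ler_wpM2r ?sqr_ge0.
Qed.

(** The first order terms cancel and the second order ones add up to - s^2 / 2. The
    remainders are of third order in the slopes, while A slope^2 is at most 1: one
    factor slope is left. *)
Lemma beta_kernel_taylor A B s : (0 < A)%N -> (0 < B)%N ->
    slope A B * `|s| <= 1 / 2 -> slope B A * `|s| <= 1 / 2 ->
  exists2 r, beta_kernel A B s = expR (- (s ^+ 2 / 2) + r) &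
    `|r| <= 2 * `|s| ^+ 3 * (slope A B + slope B A).
Proof.
move=> A0 B0.
have eA := slope_sqr B A0; have := slope_sqr A B0; rewrite addnC => eB.
have bal := slope_balance A0 B0.
have eps0 := slope_ge0 A B; have del0 := slope_ge0 B A.
rewrite /beta_kernel; move: (slope A B) (slope B A) eA eB bal eps0 del0
  => e d eA eB bal e0 d0 es ds.
have ns u : 0 <= u -> u * `|s| <= 1 / 2 -> `|u * s| <= 1 / 2.
  by move=> u0; rewrite normrM (ger0_norm u0).
have e1 : -1 < - (e * s) by have := ns _ e0 es; rewrite ler_norml; lra.
have d1 : -1 < d * s by have := ns _ d0 ds; rewrite ler_norml; lra.
have [r r0 [lr /(_ _) rs]] := ln_taylor2 e1.
have [r' r'0 [lr' /(_ _) rs']] := ln_taylor2 d1.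
have {}rs : r <= 2 * (e * s) ^+ 2 by rewrite -sqrrN rs// normrN ns.
have {}rs' : r' <= 2 * (d * s) ^+ 2 by rewrite rs'// ns.
exists (- (A%:R * r * e * s) + B%:R * r' * d * s).
  rewrite !max_r; [|lra|lra].
  rewrite -[in LHS](@lnK _ (1 - e * s)) ?posrE; last by lra.
  rewrite -[in LHS](@lnK _ (1 + d * s)) ?posrE; last by lra.
  rewrite lr lr' -!expRM_natl -expRD; congr expR.
  have AB1 : A%:R * e ^+ 2 + B%:R * d ^+ 2 = 1.
    rewrite eA eB -mulrDl -natrD addnC divff// pnatr_eq0; lia.
  transitivity (- (A%:R * e - B%:R * d) * s - (A%:R * e ^+ 2 + B%:R * d ^+ 2) * (s ^+ 2 / 2)
    + (- (A%:R * r * e * s) + B%:R * r' * d * s)); first by field.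
  by rewrite bal AB1 subrr; ring.
apply: (le_trans (ler_normD _ _)); rewrite normrN !normrM !normr_nat
  (ger0_norm r0) (ger0_norm r'0) (ger0_norm e0) (ger0_norm d0).
have h u v (rho : R) : 0 <= u -> 0 <= v -> u * v ^+ 2 <= 1 -> 0 <= rho ->
    rho <= 2 * (v * s) ^+ 2 -> u * rho * v * `|s| <= 2 * `|s| ^+ 3 * v.
  move=> u0 v0 uv rho0 rhos.
  have s2 : s ^+ 2 = `|s| ^+ 2 by rewrite real_normK// num_real.
  apply: (@le_trans _ _ (u * (2 * (v * s) ^+ 2) * v * `|s|)).
    by rewrite !ler_wpM2r// ler_wpM2l.
  have -> : u * (2 * (v * s) ^+ 2) * v * `|s| = 2 * `|s| ^+ 3 * v * (u * v ^+ 2).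
    by rewrite exprMn s2; ring.
  by rewrite ler_piMr// !mulr_ge0// exprn_ge0.
have frac (u v : nat) : u%:R / (u + v)%:R <= 1 :> R.
  have [->|u0] := posnP u; first by rewrite mul0r.
  by rewrite ler_pdivrMr ?ltr0n ?addn_gt0 ?u0// mul1r ler_nat leq_addr.
rewrite mulrDr lerD//; first by rewrite h// eA addnC frac.
by rewrite h// eB frac.
Qed.
End Kernel.

(** * Binomial probabilities as ratios of kernel integrals *)

Section KernelIntegral.
Variable R : realType.
Implicit Types (c s t y p : R) (A B : nat).
Notation mu := (@lebesgue_measure R).

Lemma binomial_lt0 m n : (0 < n)%N -> binomial_lt m n (0 : R) = 1.
Proof.
case: n => // n _; rewrite /binomial_lt big_ord_recl /= bin0 subr0 expr1n !mulr1.
by rewrite big1 ?addr0// => j _; rewrite expr0n /= mulr0 mul0r.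
Qed.

Lemma binomial_lt1 m n : (n <= m)%N -> binomial_lt m n (1 : R) = 0.
Proof.
move=> nm; rewrite /binomial_lt big1// => j _.
by rewrite subrr expr0n subn_eq0 leqNgt (leq_trans (ltn_ord j) nm) mulr0.
Qed.

Lemma continuous_affine_exp (a b : R) n : continuous (fun x : R => (a + b * x) ^+ n).
Proof.
move=> x; apply: (@continuous_comp _ _ _ (fun x => a + b * x) (fun u => u ^+ n)).
  by apply: cvgD; [exact: cvg_cst|apply: cvgMr; exact: cvg_id].
exact: exprn_continuous.
Qed.

Lemma measurable_beta_kernel A B : measurable_fun [set: R] (beta_kernel A B : R -> R).
Proof.
have h (b : R) n : measurable_fun [set: R] (fun x : R => Num.max 0 (1 + b * x) ^+ n).
  apply: measurable_funX; apply: measurable_maxr => //.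
  by apply: continuous_measurable_fun; exact: (@continuous_affine_exp 1 b 1%N).
apply: measurable_funM; last exact: h.
by under eq_fun do rewrite -mulNr; exact: h.
Qed.

(** In the coordinate of [beta_kernel], the derivative of [binomial_lt] is a constant
    multiple of [beta_kernel]. This is the reciprocal of the constant, and the
    integral of [beta_kernel] over the line by [integral_kernel]. *)
Definition kernel_mass A B : R :=
  ((A%:R / (A + B)%:R * slope R A B) * ((A + B).+1%:R * 'C(A + B, A)%:R) *
   ((A%:R / (A + B)%:R) ^+ A * (B%:R / (A + B)%:R) ^+ B))^-1.

Lemma kernel_mass_gt0 A B : (0 < A)%N -> (0 < B)%N -> 0 < kernel_mass A B.
Proof.
move=> A0 B0; have e0 := slope_gt0 R A0 B0.
have fr (u : nat) : (0 < u)%N -> 0 < u%:R / (A + B)%:R :> R.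
  by move=> u0; rewrite divr_gt0 ?ltr0n ?addn_gt0 ?A0.
by rewrite invr_gt0 !mulr_gt0 ?exprn_gt0 ?fr// ?invr_gt0 ?ltr0n ?addn_gt0 ?A0 ?bin_gt0 ?leq_addr.
Qed.

(** The fundamental theorem of calculus, started from the point [a] that
    corresponds to t = 1, where the binomial probability vanishes. *)
Lemma integral_kernel_le A B s : (0 < A)%N -> (0 < B)%N ->
    -1 < slope R B A * s -> slope R A B * s <= 1 ->
  (\int[mu]_(x in `]-oo, s]) (beta_kernel A B x)%:E =
   (kernel_mass A B *
    binomial_lt (A + B).+1 A.+1 (A%:R / (A + B)%:R * (1 - slope R A B * s)))%:E)%E.
Proof.
move=> A0 B0 ds es.
have e0 := slope_gt0 R A0 B0; have d0 := slope_gt0 R B0 A0.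
have bal := slope_balance R A0 B0.
have M0 := kernel_mass_gt0 A0 B0.
have N0 : 0 < (A + B)%:R :> R by rewrite ltr0n addn_gt0 A0.
pose G (x : R) : R := binomial_lt (A + B).+1 A.+1 (A%:R / (A + B)%:R * (1 - slope R A B * x)).
pose F (x : R) : R := kernel_mass A B * G x.
pose g (x : R) : R := (1 - slope R A B * x) ^+ A * (1 + slope R B A * x) ^+ B.
pose a : R := - (slope R B A)^-1.
have as_ : a < s by rewrite /a ltrNl -[ltRHS]mulr1 ltr_pdivlMl// mulrN; lra.
have dF (x : R) : is_derive x 1 F (g x).
  have h1 : is_derive x 1 (fun u : R => A%:R / (A + B)%:R * (1 - slope R A B * u))
      (- (A%:R / (A + B)%:R * slope R A B)).
    have h := is_deriveM (is_derive_cst (slope R A B : R) x 1) (is_derive_id x 1).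
    have {}h := is_deriveB (is_derive_cst (1 : R) x 1) h.
    have {}h := is_deriveM (is_derive_cst (A%:R / (A + B)%:R : R) x 1) h.
    apply: eq_is_derive h _ _ => // .
    by rewrite /GRing.scale /= /cst; ring.
  have h2 := is_derive1_comp (is_derive_binomial_lt A B _) h1.
  have h3 := is_deriveM (is_derive_cst (kernel_mass A B : R) x 1) h2.
  apply: eq_is_derive h3 _ _ => //.
  rewrite /GRing.scale /= /cst mulr0 addr0.
  have -> : 1 - A%:R / (A + B)%:R * (1 - slope R A B * x)
      = B%:R / (A + B)%:R * (1 + slope R B A * x).
    apply: (mulfI (lt0r_neq0 N0)).
    transitivity ((A + B)%:R - A%:R + (A%:R * slope R A B) * x).
      by field; rewrite -natrD pnatr_eq0; lia.
    by rewrite bal natrD; field; rewrite -natrD pnatr_eq0; lia.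
  transitivity (kernel_mass A B * (kernel_mass A B)^-1 * g x); last first.
    by rewrite divff ?mul1r// lt0r_neq0.
  have -> : (kernel_mass A B)^-1 =
      ((A%:R / (A + B)%:R * slope R A B) * ((A + B).+1%:R * 'C(A + B, A)%:R) *
       ((A%:R / (A + B)%:R) ^+ A * (B%:R / (A + B)%:R) ^+ B)) by exact: invrK.
  rewrite /g.
  move: (kernel_mass A B) (A%:R / _) (B%:R / _) => M t u.
  by rewrite !exprMn; ring.
have cF (x : R) : F u @[u --> x] --> F x.
  by apply: differentiable_continuous; apply/derivable1_diffP; have [] := dF x.
have -> : (\int[mu]_(x in `]-oo, s]) (beta_kernel A B x)%:E)%E
    = (\int[mu]_(x in `[a, s]) (g x)%:E)%E.
  rewrite integral_mkcond [RHS]integral_mkcond; apply: eq_integral => x _.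
  rewrite /patch !mem_setE !in_itv /=.
  have [xs|xs] := leP x s; last by rewrite andbF.
  have ex : 0 <= 1 - slope R A B * x.
    by rewrite subr_ge0 (le_trans _ es)// ler_pM2l.
  rewrite andbT; case: (leP a x) => xa.
    have dx : 0 <= 1 + slope R B A * x.
      have : slope R B A * a <= slope R B A * x by rewrite ler_pM2l.
      by rewrite /a mulrN divff ?lt0r_neq0//; lra.
    by rewrite /beta_kernel !max_r.
  have dx : 1 + slope R B A * x <= 0.
    have : slope R B A * x <= slope R B A * a by rewrite ler_pM2l// ltW.
    by rewrite /a mulrN divff ?lt0r_neq0//; lra.
  by rewrite /beta_kernel (max_l dx) expr0n (gtn_eqF B0) mulr0.
rewrite (@continuous_FTC2 R g F a s as_).
- rewrite [F a](_ : _ = 0); last first.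
    rewrite /F.
    suff -> : G a = binomial_lt (A + B).+1 A.+1 1.
      by rewrite binomial_lt1 ?ltnS ?leq_addr// mulr0.
    congr binomial_lt; rewrite /a mulrN opprK.
    apply: (mulfI (lt0r_neq0 N0)); apply: (mulfI (lt0r_neq0 d0)).
    transitivity (A%:R * slope R B A + A%:R * slope R A B).
      by field; rewrite lt0r_neq0// -natrD pnatr_eq0; lia.
    by rewrite bal natrD; ring.
  by rewrite sube0.
- apply: continuous_subspaceT => x.
  have c1 := @continuous_affine_exp 1 (- slope R A B) A x.
  have c2 := @continuous_affine_exp 1 (slope R B A) B x.
  have -> : g = (fun x => (1 + - slope R A B * x) ^+ A) * (fun x => (1 + slope R B A * x) ^+ B).
    by apply/funext => u; rewrite /g -mulNr.
  exact: cvgM c1 c2.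
- split; first by move=> x _; have [] := dF x.
  + exact/cvg_at_right_filter/cF.
  + exact/cvg_at_left_filter/cF.
- by move=> x _; rewrite derive1E; have [_ ->] := dF x.
Qed.

Lemma integral_kernel A B : (0 < A)%N -> (0 < B)%N ->
  (\int[mu]_x (beta_kernel A B x)%:E = (kernel_mass A B)%:E)%E.
Proof.
move=> A0 B0; have e0 := slope_gt0 R A0 B0; have d0 := slope_gt0 R B0 A0.
have <- : (\int[mu]_(x in `]-oo, ((slope R A B)^-1)%R]) (beta_kernel A B x)%:E
    = (kernel_mass A B)%:E)%E.
  rewrite integral_kernel_le// ?divff ?lt0r_neq0//.
    by rewrite subrr mulr0 binomial_lt0// mulr1.
  by rewrite (lt_trans (ltrN10 _))// divr_gt0.
rewrite [RHS]integral_mkcond; apply: eq_integral => x _.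
rewrite /patch mem_setE in_itv /=; case: leP => // ex.
rewrite /beta_kernel (max_l (_ : 1 - slope R A B * x <= 0)).
  by rewrite expr0n (gtn_eqF A0) mul0r.
by rewrite subr_le0 -ler_pdivrMl// mulr1 ltW.
Qed.

End KernelIntegral.

(** * The central limit theorem for binomial variables *)

Section GaussianLimit.
Variable R : realType.
Implicit Types (c s t y p : R).
Notation mu := (@lebesgue_measure R).

Definition gauss c (x : R) : R := expR (- (c * x ^+ 2 / 2)).

Lemma gauss_normal_pdf c x : 0 < c ->
  gauss c x = (normal_peak (Num.sqrt c)^-1)^-1 * normal_pdf 0 (Num.sqrt c)^-1 x.
Proof.
move=> c0; have s0 : (Num.sqrt c)^-1 != 0 by rewrite invr_eq0 gt_eqF// sqrtr_gt0.
rewrite normal_pdfE// mulKf ?gt_eqF ?normal_peak_gt0//.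
rewrite /gauss /normal_fun subr0 exprVn sqr_sqrtr ?ltW//; congr expR.
by field; rewrite gt_eqF.
Qed.

Lemma integrable_gauss c : 0 < c -> mu.-integrable [set: R] (fun x => (gauss c x)%:E).
Proof.
move=> c0; under [X in integrable _ _ X]eq_fun do rewrite gauss_normal_pdf// EFinM.
by apply: integrableZl => //; exact: integrable_normal_pdf.
Qed.

Lemma integral_gauss_le y :
  (\int[mu]_(x in `]-oo, y]) (gauss 1 x)%:E = ((normal_peak (1 : R))^-1 * Phi y)%:E)%E.
Proof.
have -> : (\int[mu]_(x in `]-oo, y]) (gauss 1 x)%:E =
    (normal_peak (1 : R))^-1%:E * \int[mu]_(x in `]-oo, y]) (normal_pdf 0 1 x)%:E)%E.
  rewrite -ge0_integralZl//=.
  - by apply: eq_integral => x _; rewrite gauss_normal_pdf// sqrtr1 invr1 -EFinM.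
  - by apply/measurable_EFinP; apply: measurable_funTS; exact: measurable_normal_pdf.
  - by move=> x _; rewrite lee_fin normal_pdf_ge0.
  - by rewrite lee_fin invr_ge0 normal_peak_ge0.
rewrite EFinM; congr (_ * _)%E.
rewrite /Phi fineK//; exact: (@fin_num_measure _ _ _ (normal_prob 0 1)).
Qed.

Lemma integral_gauss : (\int[mu]_x (gauss 1 x)%:E = ((normal_peak (1 : R))^-1)%:E)%E.
Proof.
have -> : (\int[mu]_x (gauss 1 x)%:E =
    (normal_peak (1 : R))^-1%:E * \int[mu]_x (normal_pdf 0 1 x)%:E)%E.
  rewrite -ge0_integralZl//=.
  - by apply: eq_integral => x _; rewrite gauss_normal_pdf// sqrtr1 invr1 -EFinM.
  - by apply/measurable_EFinP; exact: measurable_normal_pdf.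
  - by move=> x _; rewrite lee_fin normal_pdf_ge0.
  - by rewrite lee_fin invr_ge0 normal_peak_ge0.
by rewrite integral_normal_pdf mule1.
Qed.

Section Balanced.
Variables (A B : nat -> nat) (c : R).
Hypotheses (A0 : forall n, (0 < A n)%N) (B0 : forall n, (0 < B n)%N) (c0 : 0 < c).
Hypotheses (cA : forall n, c <= (A n)%:R / (A n + B n)%:R)
           (cB : forall n, c <= (B n)%:R / (A n + B n)%:R).
Hypothesis N_cvg : ((A n + B n)%:R^-1 : R) @[n --> \oo] --> (0 : R).

Lemma slope_cvg0 (A' B' : nat -> nat) : (forall n, (0 < A' n)%N) ->
    (forall n, c <= (A' n)%:R / (A' n + B' n)%:R) ->
    ((A' n + B' n)%:R^-1 : R) @[n --> \oo] --> (0 : R) ->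
  slope R (A' n) (B' n) @[n --> \oo] --> (0 : R).
Proof.
move=> A'0 cA' N'.
have h : Num.sqrt (c^-1 * (A' n + B' n)%:R^-1) @[n --> \oo] --> (0 : R).
  rewrite -[X in _ --> X]sqrtr0 -[X in Num.sqrt X](mulr0 c^-1).
  apply: continuous_cvg; first exact: sqrt_continuous.
  exact: cvgMr.
apply: squeeze_cvgr h; last exact: cvg_cst.
apply: nearW => n; rewrite slope_ge0 ler_sqrt; last first.
  by rewrite mulr_ge0 ?invr_ge0// ltW.
have a0 : 0 < (A' n)%:R :> R by rewrite ltr0n.
have n0 : 0 < (A' n + B' n)%:R :> R by rewrite ltr0n addn_gt0 A'0.
rewrite invfM mulrA ler_pM2r ?invr_gt0//.
rewrite ler_pdivrMr// mulrC ler_pdivlMr//.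
have := cA' n; rewrite ler_pdivlMr// mulrC; apply: le_trans.
by apply: ler_wpM2r; [exact: ltW|rewrite ler_nat leq_addl].
Qed.

Lemma beta_kernel_cvg x :
  beta_kernel (A n) (B n) x @[n --> \oo] --> gauss 1 x.
Proof.
have eA := slope_cvg0 A0 cA N_cvg.
have eB : slope R (B n) (A n) @[n --> \oo] --> (0 : R).
  apply: (slope_cvg0 B0) => [n|]; first by rewrite addnC.
  by under eq_fun do rewrite addnC.
have small (f : nat -> R) : f n @[n --> \oo] --> (0 : R) ->
    \forall n \near \oo, f n * `|x| <= 1 / 2.
  move=> f0; have : f n * `|x| @[n --> \oo] --> (0 : R).
    by rewrite -(mul0r `|x|); apply: cvgMl.
  by move/cvgr_le; apply; lra.
pose b n := 2 * `|x| ^+ 3 * (slope R (A n) (B n) + slope R (B n) (A n)).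
have b0 : b n @[n --> \oo] --> (0 : R).
  rewrite -(mulr0 (2 * `|x| ^+ 3)) -[X in _ * X](addr0 0).
  by apply: cvgMr; exact: cvgD.
have lim (f : nat -> R) : f n @[n --> \oo] --> (0 : R) ->
    expR (- (x ^+ 2 / 2) + f n) @[n --> \oo] --> gauss 1 x.
  move=> f0; rewrite /gauss mul1r -[X in expR X]addr0.
  apply: continuous_cvg; first exact: continuous_expR.
  by apply: cvgD => //; exact: cvg_cst.
apply: squeeze_cvgr (lim _ b0); last first.
  by apply: (lim (fun n => - b n)); rewrite -oppr0; exact: cvgN.
near=> n.
have [||r -> rb] := @beta_kernel_taylor R (A n) (B n) x (A0 n) (B0 n).
- by near: n; exact: small.
- by near: n; exact: small.
by rewrite !ler_expR !lerD2l -ler_norml.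
Unshelve. all: by end_near. Qed.

(** Dominated convergence. The domain may vary with [n], and its membership need
    not stabilise at one point [y]: the end of a half-line. *)
Lemma integral_beta_kernel_cvg (D_ : nat -> set R) (D : set R) y :
    (forall n, measurable (D_ n)) -> measurable D ->
    (forall x, x != y -> \forall n \near \oo, D_ n x <-> D x) ->
  (\int[mu]_(x in D_ n) (beta_kernel (A n) (B n) x)%:E)%E @[n --> \oo] -->
  (\int[mu]_(x in D) (gauss 1 x)%:E)%E.
Proof.
move=> mD_ mD DD.
have -> : (\int[mu]_(x in D) (gauss 1 x)%:E =
    \int[mu]_x ((fun x => (gauss 1 x)%:E) \_ D) x)%E by exact: integral_mkcond.
rewrite (_ : (fun n => _) = fun n =>
    (\int[mu]_x ((fun x => (beta_kernel (A n) (B n) x)%:E) \_ (D_ n)) x)%E); last first.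
  by apply/funext => n; exact: integral_mkcond.
have [] // := @dominated_convergence _ _ _ mu _ measurableT
  (fun n => (fun x => (beta_kernel (A n) (B n) x)%:E) \_ (D_ n))
  ((fun x => (gauss 1 x)%:E) \_ D) (fun x => (gauss c x)%:E).
- move=> n; apply/(measurable_restrictT _ _).1; first exact: mD_.
  by apply: measurable_funTS; apply/measurable_EFinP; exact: measurable_beta_kernel.
- apply/(measurable_restrictT _ _).1; first exact: mD.
  apply: measurable_funTS.
  by have := integrable_gauss (@ltr01 R); move/measurable_int.
- exists [set y]; split => //; first exact: lebesgue_measure_set1.
  move=> x /=; apply: contra_notP => /eqP xy _.
  have [Dx|nDx] := pselect (D x).
    rewrite {2}/patch mem_set//.
    apply: cvg_trans (_ : (beta_kernel (A n) (B n) x)%:E @[n --> \oo] --> _).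
      apply: near_eq_cvg; near=> n; rewrite /patch mem_set//.
      by have [_] : D_ n x <-> D x by [near: n; exact: DD]; exact.
    by apply: cvg_EFin; [exact: nearW|exact: beta_kernel_cvg].
  rewrite {2}/patch memNset//.
  apply: cvg_trans (_ : (cst 0%E n : \bar R) @[n --> \oo] --> _); last exact: cvg_cst.
  apply: near_eq_cvg; near=> n; rewrite /patch memNset//.
  have [h _] : D_ n x <-> D x by near: n; exact: DD.
  by move/h.
- exact: integrable_gauss.
- apply: aeW => x n _.
  apply: (@le_trans _ _ (beta_kernel (A n) (B n) x)%:E).
    rewrite /patch; case: ifPn => _; last by rewrite abse0 lee_fin beta_kernel_ge0.
    by rewrite gee0_abs// lee_fin beta_kernel_ge0.
  by rewrite lee_fin beta_kernel_le_gauss.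
Unshelve. all: by end_near. Qed.

(** The hypothesis says that [p], seen in the coordinate of [beta_kernel], tends to
    [y]. Both the integral up to [p] and the total integral converge. *)
Lemma binomial_lt_cvg p y : 0 < p < 1 ->
    ((A n)%:R / (A n + B n)%:R - p) /
      ((A n)%:R / (A n + B n)%:R * slope R (A n) (B n)) @[n --> \oo] --> y ->
  binomial_lt (A n + B n).+1 (A n).+1 p @[n --> \oo] --> Phi y.
Proof.
move=> /andP[p0 p1]; set s := fun n => (_ - p) / _ => sy.
have mass_cvg : (kernel_mass R (A n) (B n))%:E @[n --> \oo] -->
    ((normal_peak (1 : R))^-1)%:E.
  rewrite -integral_gauss.
  have -> : (fun n => (kernel_mass R (A n) (B n))%:E) =
      (fun n => \int[mu]_x (beta_kernel (A n) (B n) x)%:E)%E.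
    by apply/funext => n; rewrite integral_kernel.
  apply: (integral_beta_kernel_cvg (y := 0)) => // x _.
  exact: nearW.
have part_cvg : (kernel_mass R (A n) (B n) * binomial_lt (A n + B n).+1 (A n).+1 p)%:E
    @[n --> \oo] --> ((normal_peak (1 : R))^-1 * Phi y)%:E.
  rewrite -integral_gauss_le.
  have -> : (fun n => (kernel_mass R (A n) (B n) *
      binomial_lt (A n + B n).+1 (A n).+1 p)%:E) =
      (fun n => (\int[mu]_(x in `]-oo, s n]) (beta_kernel (A n) (B n) x)%:E)%E).
    apply/funext => n.
    have a0 : 0 < (A n)%:R :> R by rewrite ltr0n.
    have b0 : 0 < (B n)%:R :> R by rewrite ltr0n.
    have e0 := slope_gt0 R (A0 n) (B0 n); have d0 := slope_gt0 R (B0 n) (A0 n).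
    have bal := slope_balance R (A0 n) (B0 n).
    have es : slope R (A n) (B n) * s n = 1 - p * (A n + B n)%:R / (A n)%:R.
      rewrite /s natrD; field.
      by rewrite !gt_eqF ?addr_gt0.
    have ds : slope R (B n) (A n) * s n = (A n)%:R / (B n)%:R - p * (A n + B n)%:R / (B n)%:R.
      have -> : slope R (B n) (A n) = (A n)%:R * slope R (A n) (B n) / (B n)%:R.
        by rewrite bal mulrAC divff ?mul1r// gt_eqF.
      transitivity ((A n)%:R * (slope R (A n) (B n) * s n) / (B n)%:R); first by ring.
      by rewrite es; field; rewrite !gt_eqF.
    rewrite integral_kernel_le//.
    - rewrite es; congr ((_ * binomial_lt _ _ _)%:E).
      by rewrite natrD; field; rewrite !gt_eqF ?addr_gt0.
    - rewrite ds -mulrBl ltr_pdivlMr// natrD; nra.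
    - by rewrite es gerBl divr_ge0// mulr_ge0// ltW.
  apply: (integral_beta_kernel_cvg (y := y)) => //.
  move=> x; rewrite neq_lt => /orP[xy|xy].
    near=> n; split=> _ /=; rewrite in_itv /= ltW//.
    by near: n; exact: (cvgr_gt y).
  near=> n; split=> /=; rewrite in_itv /= leNgt => /negP; [|by rewrite xy].
  case; near: n; exact: (cvgr_lt y).
have pk := normal_peak_gt0 (oner_neq0 R).
have {}mass_cvg : kernel_mass R (A n) (B n) @[n --> \oo] --> (normal_peak (1 : R))^-1.
  exact: fine_cvg mass_cvg.
have {}part_cvg : kernel_mass R (A n) (B n) * binomial_lt (A n + B n).+1 (A n).+1 p
    @[n --> \oo] --> (normal_peak (1 : R))^-1 * Phi y.
  exact: fine_cvg part_cvg.
have -> : Phi y = ((normal_peak (1 : R))^-1 * Phi y) / (normal_peak (1 : R))^-1.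
  by rewrite mulrAC divff ?mul1r// invr_eq0 gt_eqF.
have -> : (fun n => binomial_lt (A n + B n).+1 (A n).+1 p) =
    (fun n => (kernel_mass R (A n) (B n) * binomial_lt (A n + B n).+1 (A n).+1 p) /
       kernel_mass R (A n) (B n)).
  by apply/funext => n; rewrite mulrAC divff ?mul1r// gt_eqF// kernel_mass_gt0.
have pk0 : (normal_peak (1 : R))^-1 != 0 by rewrite invr_eq0 gt_eqF.
by apply: cvgM part_cvg _; exact: cvgV.
Unshelve. all: by end_near. Qed.

End Balanced.
End GaussianLimit.

(** * Limits and the Gaussian distribution function *)

Section CriticalDirection.
Variable R : realType.
Implicit Types (c s t y p x a : R).
Notation mu := (@lebesgue_measure R).

Lemma inv_nat_powR_cvg0 (e : R) : 0 < e -> (n%:R^-1 : R) `^ e @[n --> \oo] --> (0 : R).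
Proof.
move=> e0; rewrite -(cvg_shiftn 1) /=.
have /cvg_at_rightP := powR_cvg0 e0; apply; split.
  by move=> n; rewrite invr_gt0 ltr0n addn1.
by under eq_fun do rewrite addn1; exact: cvg_harmonic.
Qed.

Lemma one_minus_Phi y : 1 - Phi y = fine (normal_prob (0 : R) 1 `]y, +oo[).
Proof.
have -> : `]y, +oo[%classic = ~` (`]-oo, y]%classic : set R) by rewrite setCitvl.
rewrite probability_setC// fineB//; first exact: fin_num_measure.
Qed.

(** The density is bounded below on an interval of length 1 to the right of [y]. *)
Lemma Phi_lt1 y : Phi y < 1.
Proof.
rewrite -subr_gt0 one_minus_Phi; apply: fine_gt0; apply/andP; split; last first.
  by rewrite ltey_eq fin_num_measure.
pose m : R := normal_peak 1 * expR (- ((`|y| + 1) ^+ 2 / 2)).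
have m0 : 0 < m by rewrite mulr_gt0 ?expR_gt0 ?normal_peak_gt0 ?oner_neq0.
apply: (@lt_le_trans _ _ m%:E); first by rewrite lte_fin.
apply: (@le_trans _ _ (\int[mu]_(u in `]y, (y + 1)%R[) m%:E)%E).
  rewrite integral_cst//= lebesgue_measure_itv /= lte_fin ltrDl ltr01.
  by rewrite -EFinB addrAC subrr add0r mule1.
apply: (@le_trans _ _ (\int[mu]_(u in `]y, (y + 1)%R[) (normal_pdf 0 1 u)%:E)%E).
  apply: ge0_le_integral => //=.
  - by move=> u _; rewrite lee_fin ltW.
  - by apply/measurable_EFinP; apply: measurable_funTS; exact: measurable_normal_pdf.
  move=> u; rewrite in_itv /= => /andP[yu uy]; rewrite lee_fin.
  rewrite normal_pdfE ?oner_neq0// ler_pM2l ?normal_peak_gt0 ?oner_neq0//.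
  rewrite /normal_fun subr0 expr1n ler_expR mulNr lerN2 ler_pM2r; last first.
    by rewrite invr_gt0 mulr2n; lra.
  rewrite -(real_normK (num_real u)) lerXn2r ?nnegrE ?addr_ge0//.
  have := ler_norm y; have := ler_norm (- y); rewrite normrN ler_norml; lra.
rewrite /normal_prob; apply: ge0_subset_integral => //.
- by apply/measurable_EFinP; apply: measurable_funTS; exact: measurable_normal_pdf.
- by move=> u _; rewrite lee_fin normal_pdf_ge0.
- by move=> u /=; rewrite !in_itv /= => /andP[-> _].
Qed.

Lemma Phi0 : Phi 0 = 1 / 2 :> R.
Proof.
have sym : (1 = 2 * normal_prob 0 1 `]0%R, +oo[ :> \bar R)%E.
  rewrite -(integral_normal_pdf (0 : R) 1) ge0_symfun_integralT.
  - congr (_ * _)%E; rewrite /normal_prob integral_itv_obnd_cbnd; last first.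
      by apply/measurable_EFinP; apply: measurable_funTS; exact: measurable_normal_pdf.
    by congr integral; apply/seteqP; split=> u /=; rewrite in_itv /= andbT.
  - by move=> u; exact: normal_pdf_ge0.
  - by apply: continuous_normal_pdf; exact: oner_neq0.
  - move=> u; rewrite /= !normal_pdfE ?oner_neq0//.
    by rewrite /normal_fun !subr0 sqrrN.
have := one_minus_Phi 0.
have : (normal_prob (0 : R) 1 `]0%R, +oo[ \is a fin_num) by exact: fin_num_measure.
move: sym; case: (normal_prob (0 : R) 1 _) => //= r [r1] _ h.
by lra.
Qed.

Lemma limn_esup_le (u : nat -> \bar R) (v : nat -> R) l :
    (\forall n \near \oo, (u n <= (v n)%:E)%E) -> v n @[n --> \oo] --> l ->
  (limn_esup u <= l%:E)%E.
Proof.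
move=> uv vl; apply/lee_addgt0Pr => e e0.
rewrite /limn_esup limf_esupE.
apply: (@le_trans _ _ (ereal_sup (u @` [set n | (u n <= (l + e)%:E)%E]))).
  apply: ereal_inf_lbound; exists [set n | (u n <= (l + e)%:E)%E] => //.
  near=> n => /=; apply: (@le_trans _ _ (v n)%:E); first by near: n.
  rewrite lee_fin; near: n; apply: (cvgr_le l) => //; lra.
by apply: ub_ereal_sup => _ [n /= un <-].
Unshelve. all: by end_near. Qed.

End CriticalDirection.

(** * The critical direction *)

Section CriticalScaling.
Variable R : realType.
Variables (p x a : R).
Hypotheses (p01 : 0 < p < 1) (ha : 0 < a <= 1 / 2).

Let M (n : nat) : R := (terminal_abscissa p x a n)%:R.
Let root (n : nat) : R := Num.sqrt n%:R.
(** The limit of n^a / n^(1/2). *)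
Let kappa : R := if a < 1 / 2 then 0 else 1.

Lemma inv_sqrt_cvg0 : (root n)^-1 @[n --> \oo] --> (0 : R).
Proof.
have h := @inv_nat_powR_cvg0 R (2^-1) _; move: h; rewrite invr_gt0 ltr0n => /(_ isT).
apply: cvg_trans; apply: near_eq_cvg; near=> n.
by rewrite powR12_sqrt ?invr_ge0// sqrtrV.
Unshelve. all: by end_near. Qed.

Lemma powR_div_sqrt_cvg : n%:R `^ a / root n @[n --> \oo] --> kappa.
Proof.
rewrite /kappa; case: ifPn => [a2|]; last first.
  rewrite -leNgt => a2; have -> : a = 2^-1 by move: ha; lra.
  apply: cvg_near_cst; near=> n.
  rewrite powR12_sqrt// divff// gt_eqF// sqrtr_gt0 ltr0n.
  by near: n; exact: nbhs_infty_gt.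
have e0 : 0 < 1 / 2 - a by lra.
apply: cvg_trans (inv_nat_powR_cvg0 e0); apply: near_eq_cvg; near=> n.
have n0 : (n%:R : R) != 0.
  by rewrite pnatr_eq0 -lt0n; near: n; exact: nbhs_infty_gt.
rewrite -powR_inv1// -powRrM mulN1r opprB mul1r powRB ?n0 ?implybT//.
by rewrite powR12_sqrt.
Unshelve. all: by end_near. Qed.

Lemma root_sqr n : root n * root n = n%:R.
Proof. by rewrite -expr2 sqr_sqrtr. Qed.

(** The part of the terminal abscissa lost by rounding. *)
Let frac (n : nat) : R := n%:R / p - x * n%:R `^ a - M n.

Lemma frac_bound : \forall n \near \oo, 0 <= frac n <= 1.
Proof.
have /andP[p0 p1] := p01.
have h : 1 / p - x * (n%:R `^ a / root n) * (root n)^-1 @[n --> \oo] --> 1 / p.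
  rewrite -[X in _ --> X]subr0 -(mulr0 (x * kappa)).
  apply: cvgB; first exact: cvg_cst.
  apply: cvgM inv_sqrt_cvg0; apply: cvgMr; exact: powR_div_sqrt_cvg.
near=> n.
have n0 : 0 < (n%:R : R) by rewrite ltr0n; near: n; exact: nbhs_infty_gt.
have r0 : 0 < root n by rewrite sqrtr_gt0.
have : 0 < 1 / p - x * (n%:R `^ a / root n) * (root n)^-1.
  by near: n; apply: (cvgr_gt _ h); rewrite divr_gt0.
rewrite -mulrA -mulrA -invfM root_sqr => pos.
have : 0 <= n%:R / p - x * n%:R `^ a.
  have -> : n%:R / p - x * n%:R `^ a = n%:R * (1 / p - x * (n%:R `^ a * n%:R^-1)).
    by field; rewrite !gt_eqF.
  by rewrite mulr_ge0// ltW.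
move=> /truncn_itv; rewrite /frac /M /terminal_abscissa -natr1.
lra.
Unshelve. all: by end_near. Qed.

Lemma terminal_abscissa_cvg : M n / n%:R @[n --> \oo] --> p^-1.
Proof.
have h : p^-1 - x * (n%:R `^ a / root n) * (root n)^-1 @[n --> \oo] --> p^-1.
  rewrite -[X in _ --> X]subr0 -(mulr0 (x * kappa)).
  apply: cvgB; first exact: cvg_cst.
  apply: cvgM inv_sqrt_cvg0; apply: cvgMr; exact: powR_div_sqrt_cvg.
have h2 : p^-1 - x * (n%:R `^ a / root n) * (root n)^-1 - (root n)^-1 * (root n)^-1
    @[n --> \oo] --> p^-1.
  rewrite -[X in _ --> X]subr0 -[X in _ - X](mulr0 0).
  by apply: cvgB => //; apply: cvgM inv_sqrt_cvg0 inv_sqrt_cvg0.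
apply: squeeze_cvgr h2 h.
near=> n.
have n0 : 0 < (n%:R : R) by rewrite ltr0n; near: n; exact: nbhs_infty_gt.
have : 0 <= frac n <= 1 by near: n; exact: frac_bound.
rewrite -!mulrA -invfM root_sqr.
have -> : M n = n%:R / p - x * n%:R `^ a - frac n by rewrite /frac; ring.
have i0 : 0 < (n%:R : R)^-1 by rewrite invr_gt0.
move=> /andP[f0 f1].
have -> : (n%:R / p - x * n%:R `^ a - frac n) / n%:R =
    p^-1 - x * (n%:R `^ a * n%:R^-1) - frac n * n%:R^-1.
  by field; rewrite !gt_eqF//; have /andP[] := p01.
have : 0 <= frac n * n%:R^-1 <= n%:R^-1.
  by rewrite mulr_ge0 ?ler_piMl// ltW.
lra.
Unshelve. all: by end_near. Qed.

(** With n = k + 1 and terminal abscissa k + l + 1, these are k, l and k + l. *)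
Let A (n : nat) : R := n%:R - 1.
Let B (n : nat) : R := M n - n%:R.
Let N (n : nat) : R := M n - 1.

Lemma inv_nat_cvg0 : (n%:R^-1 : R) @[n --> \oo] --> (0 : R).
Proof.
have -> : (fun n => n%:R^-1 : R) = (fun n => (root n)^-1 * (root n)^-1).
  by apply/funext => n; rewrite -invfM root_sqr.
by rewrite -(mulr0 0); exact: cvgM inv_sqrt_cvg0 inv_sqrt_cvg0.
Qed.

Let theta_cvg : M n / n%:R - n%:R^-1 @[n --> \oo] --> p^-1.
Proof.
rewrite -[X in _ --> X]subr0.
exact: cvgB terminal_abscissa_cvg inv_nat_cvg0.
Qed.

Let ip_neq0 : p^-1 != 0.
Proof. by rewrite invr_eq0 gt_eqF//; have /andP[] := p01. Qed.

Lemma ratioA_cvg : A n / N n @[n --> \oo] --> p.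
Proof.
have h : (1 - n%:R^-1) / (M n / n%:R - n%:R^-1) @[n --> \oo] --> p.
  rewrite -[X in _ --> X]mul1r -[X in _ * X]invrK -[X in X * _]subr0.
  apply: cvgM; last exact: cvgV.
  by apply: cvgB inv_nat_cvg0; exact: cvg_cst.
apply: cvg_trans h; apply: near_eq_cvg; near=> n.
have n0 : 0 < (n%:R : R) by rewrite ltr0n; near: n; exact: nbhs_infty_gt.
have -> : 1 - n%:R^-1 = A n / n%:R by rewrite /A mulrBl divff ?gt_eqF// mul1r.
rewrite -[X in _ - X]mul1r -mulrBl -/(N n) invf_div mulrA divfK// gt_eqF//.
Unshelve. all: by end_near. Qed.

Lemma ratioB_cvg : B n / N n @[n --> \oo] --> 1 - p.
Proof.
have /andP[p0 p1] := p01.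
have h : (M n / n%:R - 1) / (M n / n%:R - n%:R^-1) @[n --> \oo] --> 1 - p.
  have -> : 1 - p = (p^-1 - 1) / p^-1.
    by rewrite invrK mulrBl mulVf ?gt_eqF// mul1r.
  apply: cvgM; last exact: cvgV.
  by apply: cvgB; [exact: terminal_abscissa_cvg|exact: cvg_cst].
apply: cvg_trans h; apply: near_eq_cvg; near=> n.
have n0 : 0 < (n%:R : R) by rewrite ltr0n; near: n; exact: nbhs_infty_gt.
have -> : M n / n%:R - 1 = B n / n%:R by rewrite /B mulrBl divff ?gt_eqF.
rewrite -[X in _ - X]mul1r -mulrBl -/(N n) invf_div mulrA divfK// gt_eqF//.
Unshelve. all: by end_near. Qed.

Lemma invN_cvg0 : (N n)^-1 @[n --> \oo] --> (0 : R).
Proof.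
have h : n%:R^-1 / (M n / n%:R - n%:R^-1) @[n --> \oo] --> (0 : R).
  rewrite -[X in _ --> X](mul0r (p^-1)^-1).
  by apply: cvgM inv_nat_cvg0 _; exact: cvgV.
apply: cvg_trans h; apply: near_eq_cvg; near=> n.
have n0 : 0 < (n%:R : R) by rewrite ltr0n; near: n; exact: nbhs_infty_gt.
rewrite -[X in _ - X]mul1r -mulrBl -/(N n) invf_div mulrA mulVf ?mul1r// gt_eqF//.
Unshelve. all: by end_near. Qed.

(** The position of [p] in the coordinate of [beta_kernel], see [standardisedE]. *)
Let z (n : nat) : R := (p * x * (n%:R `^ a / root n) + (p * frac n - (1 - p)) * (root n)^-1)
  / Num.sqrt ((1 - n%:R^-1) * (B n / N n)).

Lemma standardised_cvg : z n @[n --> \oo] --> x * p * kappa / Num.sqrt (1 - p).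
Proof.
have /andP[p0 p1] := p01.
have fr : frac n * (root n)^-1 @[n --> \oo] --> (0 : R).
  apply: squeeze_cvgr (cvg_cst 0) inv_sqrt_cvg0.
  near=> n; have /andP[f0 f1] : 0 <= frac n <= 1 by near: n; exact: frac_bound.
  have r0 : 0 <= (root n)^-1 by rewrite invr_ge0 sqrtr_ge0.
  by rewrite mulr_ge0 ?ler_piMl.
apply: cvgM.
  rewrite [x * p]mulrC -[X in _ --> X]addr0; apply: cvgD.
    by apply: cvgMr; exact: powR_div_sqrt_cvg.
  have -> : (fun n => (p * frac n - (1 - p)) * (root n)^-1) =
      (fun n => p * (frac n * (root n)^-1) - (1 - p) * (root n)^-1).
    by apply/funext => n; rewrite mulrBl mulrA.
  have <- : p * 0 - (1 - p) * 0 = 0 :> R by rewrite !mulr0 subr0.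
  by apply: cvgB; apply: cvgMr => //; exact: inv_sqrt_cvg0.
apply: cvgV; first by rewrite gt_eqF// sqrtr_gt0 subr_gt0.
apply: continuous_cvg; first exact: sqrt_continuous.
rewrite -[X in _ --> X]mul1r -[X in X * _]subr0.
apply: cvgM ratioB_cvg.
by apply: cvgB inv_nat_cvg0; exact: cvg_cst.
Unshelve. all: by end_near. Qed.

Let coordinatesE (n k l : nat) : n = k.+1 ->
    terminal_abscissa p x a n = (k + l).+1 ->
  [/\ A n = k%:R, B n = l%:R & N n = (k + l)%:R].
Proof.
move=> nk Mkl; rewrite /A /B /N /M Mkl nk; split.
- by rewrite -natr1 addrK.
- by rewrite -addSn natrD addrC addKr.
- by rewrite -natr1 addrK.
Qed.

Lemma standardisedE (n k l : nat) : n = k.+1 -> (0 < k)%N -> (0 < l)%N ->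
    terminal_abscissa p x a n = (k + l).+1 ->
  (k%:R / (k + l)%:R - p) / (k%:R / (k + l)%:R * slope R k l) = z n.
Proof.
move=> nk k0 l0 Mkl; have /andP[p0 p1] := p01.
have [AE BE NE] := coordinatesE nk Mkl.
have k0' : 0 < (k%:R : R) by rewrite ltr0n.
have l0' : 0 < (l%:R : R) by rewrite ltr0n.
have N0 : 0 < ((k + l)%:R : R) by rewrite ltr0n addn_gt0 k0.
have n0 : 0 < (n%:R : R) by rewrite nk ltr0n.
have r0 : 0 < root n by rewrite sqrtr_gt0.
have e0 := slope_gt0 R k0 l0.
rewrite /z BE NE.
have -> : p * x * (n%:R `^ a / root n) + (p * frac n - (1 - p)) * (root n)^-1 =
    (k%:R - p * (k + l)%:R) / root n.
  rewrite -AE -NE /A /N /frac.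
  by field; rewrite !gt_eqF.
have sE : root n * Num.sqrt ((1 - n%:R^-1) * (l%:R / (k + l)%:R)) = k%:R * slope R k l.
  rewrite -sqrtrM// -[in RHS](ger0_norm (ltW k0')) -sqrtr_sqr -sqrtrM ?sqr_ge0//.
  congr Num.sqrt.
  have -> : n%:R * ((1 - n%:R^-1) * (l%:R / (k + l)%:R)) = k%:R * (l%:R / (k + l)%:R) :> R.
    by rewrite mulrA mulrBr divff ?gt_eqF// mulr1 -/(A n) AE.
  by field; rewrite -natrD !gt_eqF.
rewrite -[RHS]mulrA -[X in _ = _ * X]invfM sE; field.
by rewrite -natrD !gt_eqF.
Qed.

Lemma binomial_lt_critical_cvg :
  binomial_lt (terminal_abscissa p x a n) n p @[n --> \oo] -->
  Phi (x * p * kappa / Num.sqrt (1 - p)).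
Proof.
have /andP[p0 p1] := p01.
pose c := Num.min p (1 - p) / 2.
have mm : 0 < Num.min p (1 - p) by rewrite lt_min p0 subr_gt0.
have c0 : 0 < c by rewrite divr_gt0.
have cp : c < p.
  have : Num.min p (1 - p) <= p by rewrite ge_min lexx.
  by rewrite /c; lra.
have cq : c < 1 - p.
  have : Num.min p (1 - p) <= 1 - p by rewrite ge_min lexx orbT.
  by rewrite /c; lra.
have [n0 _ good] : \forall n \near \oo, [/\ (1 < n)%N, (n < terminal_abscissa p x a n)%N,
    c <= A n / N n & c <= B n / N n].
  near=> n.
  have n0 : 0 < (n%:R : R) by rewrite ltr0n; near: n; exact: nbhs_infty_gt.
  split.
  - by near: n; exact: nbhs_infty_gt.
  - rewrite -(ltr_nat R) -/(M n) -[ltLHS]mul1r -ltr_pdivlMr//.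
    near: n; apply: (cvgr_gt _ terminal_abscissa_cvg).
    by rewrite invf_gt1.
  - by near: n; exact: (cvgr_ge _ ratioA_cvg).
  - by near: n; exact: (cvgr_ge _ ratioB_cvg).
pose k n := (n + n0).-1; pose l n := (terminal_abscissa p x a (n + n0) - (n + n0))%N.
have goodk n : [/\ (n + n0 = (k n).+1)%N, (0 < k n)%N, (0 < l n)%N,
    terminal_abscissa p x a (n + n0) = (k n + l n).+1 &
    c <= (k n)%:R / (k n + l n)%:R /\ c <= (l n)%:R / (k n + l n)%:R :> R].
  have [] := good (n + n0)%N; first by rewrite /= leq_addl.
  move=> n1 nM cA cB.
  have e1 : (n + n0 = (k n).+1)%N by rewrite /k; lia.
  have e2 : terminal_abscissa p x a (n + n0) = (k n + l n).+1 by rewrite /k /l; lia.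
  split=> //; [by rewrite /k; lia|by rewrite /l; lia|].
  by move: cA cB; have [-> -> ->] := coordinatesE e1 e2.
(* Dropping the first n0 terms makes the bounds needed by the domination
   hold at every index. *)
rewrite -(cvg_shiftn n0) /=.
have -> : (fun n => binomial_lt (terminal_abscissa p x a (n + n0)) (n + n0) p) =
    (fun n => binomial_lt (k n + l n).+1 (k n).+1 p).
  by apply/funext => n; have [e1 _ _ e2 _] := goodk n; rewrite e2 e1.
apply: (binomial_lt_cvg _ _ c0) => //.
- by move=> n; have [] := goodk n.
- by move=> n; have [] := goodk n.
- by move=> n; have [_ _ _ _ []] := goodk n.
- by move=> n; have [_ _ _ _ []] := goodk n.
- have := invN_cvg0; rewrite -(cvg_shiftn n0) /=.
  have -> : (fun n => (N (n + n0))^-1) = (fun n => (k n + l n)%:R^-1); last by [].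
  by apply/funext => n; have [e1 _ _ e2 _] := goodk n; have [_ _ ->] := coordinatesE e1 e2.
- have := standardised_cvg; rewrite -(cvg_shiftn n0) /=.
  have -> : (fun n => z (n + n0)) = (fun n => ((k n)%:R / (k n + l n)%:R - p) /
      ((k n)%:R / (k n + l n)%:R * slope R (k n) (l n))); last by [].
  by apply/funext => n; have [e1 k0 l0 e2 _] := goodk n; rewrite -(standardisedE e1 k0 l0 e2).
Unshelve. all: by end_near. Qed.

End CriticalScaling.

Theorem corollary2p2 (R : realType) (d : measure_display)
    (T : measurableType d) (P : probability T R) (p q x a : R)
    (omega : site -> {RV P >-> bool}) (hp : 0 < p < 1) (hq : q = 1 - p)
    (ha : 0 < a <= 1 / 2) (homega : iid_bernoulli_field p omega) :
  (limn_esup (fun n : nat =>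
     'E_P[fun t => (num_regions R (fun ij => omega ij t)
                      (terminal_abscissa p x a n) n)%:R])
   <= (if a < 1 / 2 then 2 else (1 - Phi (x * p * q `^ (- (1 / 2))))^-1)%:E)%E.
Proof.
set y := x * p * (if a < 1 / 2 then 0 else 1) / Num.sqrt (1 - p).
have -> : (if a < 1 / 2 then 2 else (1 - Phi (x * p * q `^ (- (1 / 2))))^-1) =
    (1 - Phi y)^-1.
  rewrite /y; case: ifPn => _; first by rewrite mulr0 mul0r Phi0; field.
  rewrite mulr1 powRN div1r powR12_sqrt hq// subr_ge0.
  by case/andP: hp => _ /ltW.
have Fy := binomial_lt_critical_cvg (x := x) hp ha; rewrite -/y in Fy.
apply: (limn_esup_le (v := fun n => (1 - binomial_lt (terminal_abscissa p x a n) n p)^-1)).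
  near=> n; apply: (expectation_num_regions hp homega).
  by near: n; apply: (cvgr_lt (Phi y)) => //; exact: Phi_lt1.
apply: cvgV; first by rewrite gt_eqF// subr_gt0 Phi_lt1.
by apply: cvgB Fy; exact: cvg_cst.
Unshelve. all: by end_near. Qed.
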